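(* Let $N\in\{2,3\}$, let $k>0$, let $R>0$, let $S=\partial B(0,R)\subset\mathbb{R}^N$ (a circle if $N=2$, a sphere if $N=3$), and let $\Omega$ be a nonempty open set contained in the open ball $B(0,R)$. Define the operator $\mathcal{T}: L^2(S)\to C^\infty(\Omega)$ by $$\mathcal{T}(u)(x):=\langle u, G(x,\cdot)\rangle_{L^2(S)}=\int_S u(y)\,\overline{G(x,y)}\,ds(y),\qquad x\in\Omega .$$ Then $\mathcal{T}$ is injective: if $u_1,u_2\in L^2(S)$ satisfy $\mathcal{T}(u_1)(x)=\mathcal{T}(u_2)(x)$ for all $x\in\Omega$, then $u_1=u_2$ in $L^2(S)$.
   Context: $G$ is the free-space Green's function of the Helmholtz equation with wavenumber $k$: $G(x,y)=\frac{\mathbf{i}}{4}H_0^{(1)}(k|x-y|)$ for $N=2$, where $H_0^{(1)}$ is the Hankel function of the first kind of order $0$, and $G(x,y)=\frac{\exp(-\mathbf{i}k|x-y|)}{4\pi|x-y|}$ for $N=3$. The bar denotes complex conjugation and $ds$ is the surface (arc-length) measure on $S$. *)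

(* Defs.v *)
(* MathComp + MathComp-Analysis (R : realType), complex numbers R[i]
   from mathcomp-real-closed. *)
From HB Require Import structures.
From mathcomp Require Import all_boot all_order all_algebra.
From mathcomp Require Import all_classical all_reals all_analysis.
From mathcomp Require Import complex.
Set Implicit Arguments. Unset Strict Implicit. Unset Printing Implicit Defensive.
Import Order.TTheory GRing.Theory Num.Theory.
Import numFieldNormedType.Exports.
Local Open Scope classical_set_scope.
Local Open Scope ring_scope.
Local Open Scope complex_scope.

(* Euclidean geometry of R^N, points being row vectors 'rV[R]_N.        *)
(* (The library norm on 'rV is the max-norm, so the Euclidean norm is   *)
(*  defined explicitly; both induce the same topology, used for "open".)*)

Definition eucl_norm (R : realType) (N : nat) (x : 'rV[R]_N) : R :=
  Num.sqrt (\sum_(i < N) x ord0 i ^+ 2).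

(* open Euclidean ball B(0, r) *)
Definition eball (R : realType) (N : nat) (r : R) : set 'rV[R]_N :=
  [set x | eucl_norm x < r].

(* Bessel functions J_0, Y_0 and the Hankel function H_0^(1) on (0,oo) *)

(* harmonic number H_m = 1 + 1/2 + ... + 1/m *)
Definition harmonic (R : realType) (m : nat) : R :=
  \sum_(j < m) (j.+1%:R)^-1.

(* Euler--Mascheroni constant *)
Definition euler_gamma (R : realType) : R :=
  limn (fun n : nat => @harmonic R n - ln (n%:R : R)).

(* J_0(z) = sum_{m>=0} (-1)^m (z/2)^(2m) / (m!)^2 *)
Definition besselJ0 (R : realType) (z : R) : R :=
  limn (series (fun m : nat =>
          (-1) ^+ m * (z / 2) ^+ (2 * m) / (m`!%:R) ^+ 2)).

(* Y_0(z) = (2/pi) [ (ln(z/2) + gamma) J_0(z)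
                     + sum_{m>=1} (-1)^(m+1) H_m (z/2)^(2m) / (m!)^2 ],  z > 0 *)
Definition besselY0 (R : realType) (z : R) : R :=
  (2 / pi) * ((ln (z / 2) + @euler_gamma R) * besselJ0 z
    + limn (series (fun m : nat =>
          (-1) ^+ m.+2 * @harmonic R m.+1 * (z / 2) ^+ (2 * m.+1)
            / (m.+1`!%:R) ^+ 2))).

(* Hankel function of the first kind of order 0: H_0^(1) = J_0 + i Y_0 *)
Definition hankel01 (R : realType) (z : R) : R[i] :=
  (besselJ0 z)%:C + 'i * (besselY0 z)%:C.

(* Free-space Green's function of the Helmholtz equation with          *)
(* wavenumber k, for N = 2 and N = 3 (as in the paper).                *)
Definition green (R : realType) (N : nat) (k : R) (x y : 'rV[R]_N) : R[i] :=
  let d := eucl_norm (x - y) in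
  if N == 2%N then ('i / 4%:R) * hankel01 (k * d)
  else ((cos (k * d))%:C - 'i * (sin (k * d))%:C) / (4 * pi * d)%:C.

(* The sphere S = boundary of B(0,r) and its surface measure ds,        *)
(* via the standard parametrizations:                                   *)
(*   N = 2 : y = r (cos t, sin t),  t in [0, 2pi),  ds = r dt           *)
(*   N = 3 : y = r (sin p cos t, sin p sin t, cos p),                   *)
(*           (p, t) in [0, pi] x [0, 2pi),  ds = r^2 sin p dp dt        *)
Definition circle_pt (R : realType) (N : nat) (r t : R) : 'rV[R]_N :=
  \row_(i < N) nth 0 [:: r * cos t; r * sin t] i.

Definition sphere_pt (R : realType) (N : nat) (r : R) (pt : R * R) : 'rV[R]_N :=
  \row_(i < N) nth 0 [:: r * sin pt.1 * cos pt.2; r * sin pt.1 * sin pt.2;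
                          r * cos pt.1] i.

Definition circle_dom (R : realType) : set R := `[0, 2 * pi[.
Definition sphere_dom (R : realType) : set (R * R) :=
  (`[0, pi] : set R) `*` (`[0, 2 * pi[ : set R).

(* surface integral  int_S f ds  of an extended-real valued function *)
Definition surf_int (R : realType) (N : nat) (r : R) (f : 'rV[R]_N -> \bar R)
  : \bar R :=
  if N == 2%N then
    (\int[lebesgue_measure]_(t in @circle_dom R)
        (f (circle_pt N r t) * r%:E))%E
  else
    (\int[(lebesgue_measure \x lebesgue_measure)%E]_(pt in @sphere_dom R)
        (f (sphere_pt N r pt) * (r ^+ 2 * sin pt.1)%:E))%E.

(* surface integral of a complex valued function (real and imaginary parts) *)
Definition surf_intC (R : realType) (N : nat) (r : R) (f : 'rV[R]_N -> R[i])
  : R[i] :=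
  (fine (surf_int r (fun y => (complex.Re (f y))%:E)))%:C
  + 'i * (fine (surf_int r (fun y => (complex.Im (f y))%:E)))%:C.

(* squared modulus of a complex number *)
Definition sqmod (R : realType) (z : R[i]) : R :=
  complex.Re z ^+ 2 + complex.Im z ^+ 2.

(* u (a function defined on R^N, only its restriction to S matters) is a
   representative of an element of L^2(S): measurable on S (through the
   parametrization) and square integrable for ds. *)
Definition L2S (R : realType) (N : nat) (r : R) (u : 'rV[R]_N -> R[i]) : Prop :=
  (if N == 2%N then
     measurable_fun (@circle_dom R) (fun t => complex.Re (u (circle_pt N r t)))
     /\ measurable_fun (@circle_dom R) (fun t => complex.Im (u (circle_pt N r t)))
   else
     measurable_fun (@sphere_dom R) (fun pt => complex.Re (u (sphere_pt N r pt)))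
     /\ measurable_fun (@sphere_dom R) (fun pt => complex.Im (u (sphere_pt N r pt))))
  /\ (surf_int r (fun y => (sqmod (u y))%:E) < +oo)%E.

(* T(u)(x) = < u, G(x, .) >_{L^2(S)} = int_S u(y) conj(G(x,y)) ds(y) *)
Definition opT (R : realType) (N : nat) (k r : R) (u : 'rV[R]_N -> R[i])
  (x : 'rV[R]_N) : R[i] :=
  surf_intC r (fun y => u y * (green k x y)^*).

(* Main.v *)
(** Put [s = |x - y| ^ 2].  As a function of [s], the conjugate of [green] is
    [A s + i B s], where both [A] and [B] solve [4 s g'' + 2 N g' + k ^ 2 g = 0].  Hence their
    derivatives of every order satisfy a three-term recursion, which yields bounds
    [C K ^ n n!] (so the potential of a density on the sphere is analytic along
    lines, and vanishing near a point of the ball propagates to the origin), and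
    which preserves the non-vanishing of the Wronskian (so the n-th derivatives
    of [A] and [B] are never both zero).  Expanding the potential at the origin
    then shows, by induction on [n], that the density is orthogonal to every
    [(v . y) ^ n].  Applying polynomials that converge boundedly to step functions
    turns this into the vanishing of the integrals over subintervals (after
    Fubini when [N = 3]), hence of the density. *)

Require Import Defs.
From HB Require Import structures.
From mathcomp Require Import all_boot all_order all_algebra.
From mathcomp Require Import all_classical all_reals all_analysis.
From mathcomp Require Import complex measurable_realfun ring lra.
Import Order.TTheory GRing.Theory Num.Theory.
Import numFieldNormedType.Exports.
Local Open Scope classical_set_scope.
Local Open Scope ring_scope.
Set Implicit Arguments. Unset Strict Implicit. Unset Printing Implicit Defensive.

(** * Derivatives and Taylor bounds for the radial Helmholtz equation *)

(** The squared distance is chosen as variable because along a line it is a quadratic polynomial in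
    the parameter, so expanding the potential amounts to substituting a quadratic into a Taylor
    series. In [s] the Laplacian reads [4 s g'' + 2 N g'], and differentiating the equation n times
    replaces [N] by [N + 2 n]: up to a constant and a power of [s], the n-th derivatives of the
    kernel are Hankel functions of order [N / 2 - 1 + n] at [k * sqrt s]. These have no positive
    zero, whereas their regular (Bessel) parts vanish at [s = r ^ 2] when [k ^ 2] is a suitable
    Dirichlet eigenvalue of the ball. This is why the real and imaginary parts of the kernel are
    kept together, and why no value of [k] is exceptional. The origin is the centre of the final
    expansion because there [s = r ^ 2] for every [y] on the sphere, so the derivatives of the
    kernel leave the integral and only powers of [v . y] remain. Mixed moments are recovered from
    those powers by polarisation. *)

Section RealDerivative.
Context {R : realType}.
Implicit Types (f g : R -> R) (x a b : R).

Lemma derD f g x a b : is_derive x (1:R) f a -> is_derive x (1:R) g b ->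
  is_derive x (1:R) (fun t => f t + g t) (a + b).
Proof. by move=> F G; exact: is_deriveD. Qed.

Lemma derN f x a : is_derive x (1:R) f a -> is_derive x (1:R) (fun t => - f t) (- a).
Proof. by move=> F; exact: is_deriveN. Qed.

Lemma derM f g x a b : is_derive x (1:R) f a -> is_derive x (1:R) g b ->
  is_derive x (1:R) (fun t => f t * g t) (a * g x + f x * b).
Proof.
move=> F G.
have H := is_deriveM F G.
apply: is_derive_eq H _.
by rewrite /GRing.scale /= addrC (mulrC a).
Qed.

Lemma derC c x : is_derive x (1:R) (fun=> c : R) 0.
Proof. exact: is_derive_cst. Qed.

Lemma derV f x a : f x != 0 -> is_derive x (1:R) f a ->
  is_derive x (1:R) (fun t => (f t)^-1) (- (f x) ^- 2 * a).
Proof. by move=> fx F; exact: is_deriveV. Qed.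

Lemma derZ c f x a : is_derive x (1:R) f a -> is_derive x (1:R) (fun t => c * f t) (c * a).
Proof. by move=> F; exact: is_deriveZ. Qed.

Lemma der_comp f g x a b : is_derive (g x) (1:R) f a -> is_derive x (1:R) g b ->
  is_derive x (1:R) (fun t => f (g t)) (a * b).
Proof. by move=> F G; exact: is_derive1_comp. Qed.

Lemma der_eq f g x a b : is_derive x (1:R) f a -> f =1 g -> a = b ->
  is_derive x (1:R) g b.
Proof. by move=> + /funext <- <-. Qed.

Lemma derXn n f x a : is_derive x (1:R) f a ->
  is_derive x (1:R) (fun t => f t ^+ n) (n%:R * f x ^+ n.-1 * a).
Proof.
move=> F; elim: n => [|n IH].
  by apply: der_eq (derC 1 x) _ _ => [t|]; rewrite ?expr0 // mul0r mul0r.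
apply: der_eq (derM F IH) _ _ => [t|]; first by rewrite exprS.
case: n {IH} => [|n] /=; first by rewrite expr0; ring.
by rewrite !exprS -[n.+2%:R]natr1; ring.
Qed.

Lemma der_continuous f x a : is_derive x (1:R) f a -> {for x, continuous f}.
Proof. by case=> F _; exact/differentiable_continuous/derivable1_diffP. Qed.

Lemma mean_value_le f df a b L : (forall x, Num.min a b <= x <= Num.max a b ->
    is_derive x (1:R) f (df x)) ->
  (forall x, Num.min a b <= x <= Num.max a b -> `|df x| <= L) ->
  `|f b - f a| <= L * `|b - a|.
Proof.
wlog ab : a b / a <= b => [H Hd HL|].
  have [ab|/ltW ab] := leP a b; first by apply: H.
  by rewrite distrC (distrC b); apply: H => //; rewrite minC maxC.
rewrite (min_idPl ab) (max_idPr ab) => Hd HL.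
have [||c] := @MVT_segment _ f df a b ab.
- by move=> x xab; apply: Hd; rewrite !(itvP xab).
- apply: continuous_in_subspaceT => x; rewrite inE /= => xab.
  by apply: (@der_continuous _ _ (df x)); apply: Hd; rewrite !(itvP xab).
move=> cab ->; rewrite normrM ler_wpM2r //; apply: HL.
by rewrite !(itvP cab).
Qed.

Lemma continuous_bounded f a b : (forall x, a <= x <= b -> {for x, continuous f}) ->
  exists2 C, 0 <= C & forall x, a <= x <= b -> `|f x| <= C.
Proof.
move=> cf; have [ab|ba] := leP a b; last first.
  by exists 0 => // x /andP[ax xb]; move: ba; rewrite ltNge (le_trans ax xb).
have [|c _ H] := @EVT_max _ (fun x => `|f x|) a b ab.
  apply: continuous_in_subspaceT => x; rewrite inE /= => xab.
  by apply: continuous_comp; [apply: cf; rewrite !(itvP xab)|exact: norm_continuous].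
exists `|f c| => // x xab; apply: H; by rewrite in_itv.
Qed.

End RealDerivative.

(* [g n] is the n-th derivative of [g 0], a radial solution of the Helmholtz
   equation in dimension [N] written as a function of the squared distance. *)
Record radial {R : realType} (N : nat) (k : R) (g : nat -> R -> R) : Prop := Radial {
  radial_derive : forall n (s : R), 0 < s -> is_derive s (1 : R) (g n) (g n.+1 s);
  radial_ode : forall n (s : R), 0 < s ->
    4 * s * g n.+2 s + (4 * n%:R + 2 * N%:R) * g n.+1 s + k ^+ 2 * g n s = 0 }.
Arguments radial_derive {R N k g}.
Arguments radial_ode {R N k g}.

(** The equation of [radial_ode] solved for its top term: it turns a function and its first
    derivative into explicit candidates for all higher derivatives. *)
Fixpoint radial_seq {R : realType} (N : nat) (k : R) (g0 g1 : R -> R) (n : nat) : R -> R :=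
  match n with
  | 0 => g0
  | n1.+1 => match n1 with
    | 0 => g1
    | n2.+1 => fun s => - ((4 * n2%:R + 2 * N%:R) * radial_seq N k g0 g1 n1 s
                           + k ^+ 2 * radial_seq N k g0 g1 n2 s) / (4 * s)
    end
  end.

(** * Factorial bounds and Taylor remainders for radial solutions *)

Section RadialChain.
Context {R : realType} (N : nat) (k : R).
Implicit Types (s d M : R) (g : nat -> R -> R).

(** Only the two lowest levels have to be checked: differentiating the recursion at level [n]
    produces the recursion at level [n.+1]. As the recursion has order two, the induction carries
    two consecutive levels. *)
Lemma radial_seqP (g0 g1 : R -> R) :
  (forall s, 0 < s -> is_derive s (1 : R) g0 (g1 s)) ->
  (forall s, 0 < s -> is_derive s (1 : R) g1
     (- (2 * N%:R * g1 s + k ^+ 2 * g0 s) / (4 * s))) ->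
  radial N k (radial_seq N k g0 g1).
Proof.
move=> H0 H1; pose G := radial_seq N k g0 g1; rewrite -/G.
have G0 : G 0%N = g0 by [].
have G1 : G 1%N = g1 by [].
have E n s : G n.+2 s =
  - ((4 * n%:R + 2 * N%:R) * G n.+1 s + k ^+ 2 * G n s) / (4 * s) by [].
clearbody G; split; last first.
  by move=> n s s0; have s1 : s != 0 by [rewrite gt_eqF]; rewrite E; field.
move=> n s s0; have s1 : s != 0 by rewrite gt_eqF.
suff : is_derive s (1 : R) (G n) (G n.+1 s) /\
       is_derive s (1 : R) (G n.+1) (G n.+2 s) by case.
elim: n => [|n [IH1 IH2]].
  split; first by rewrite G0 G1; exact: H0.
  rewrite E G0 G1; apply: der_eq (H1 s s0) _ _ => //.
  by congr (- (_ * _ + _) / _); ring.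
split; first exact: IH2.
have s4 : 4 * s != 0 by rewrite mulf_neq0.
apply: der_eq (derM (derN (derD (derZ (4 * n%:R + 2 * N%:R) IH2) (derZ (k ^+ 2) IH1)))
  (derV s4 (derZ 4 (is_derive_id s 1)))) _ _ => [t|].
  by rewrite E.
by rewrite (E n.+1) (E n); field.
Qed.

(** Each use of the recursion divides by [4 s >= 4 d] and multiplies by a factor that is affine in
    [n]; the affine factors make up the factorial and the rest goes into [K]. *)
Lemma radial_bound g d M : radial N k g -> 0 < d ->
  exists C K, [/\ 0 < C, 0 < K & forall n s, d <= s <= M ->
    `|g n s| <= C * K ^+ n * n`!%:R].
Proof.
move=> rg d0.
have cont n x : d <= x <= M -> {for x, continuous (g n)}.
  move=> /andP[dx _]; apply: (@der_continuous _ _ _ (g n.+1 x)).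
  by apply: (radial_derive rg); exact: lt_le_trans dx.
have [C0 C00 H0] := continuous_bounded (cont 0%N).
have [C1 C10 H1] := continuous_bounded (cont 1%N).
(* Chosen so that [K * s] exceeds [4 + 2 * N + k ^ 2] for all [s >= d]; the summand 1 gives
   [1 <= K], which lets the term two levels down be absorbed as well. *)
pose K := 1 + (4 + 2 * N%:R + k ^+ 2) / d.
have K1 : 1 <= K by rewrite lerDl divr_ge0 ?(ltW d0) ?addr_ge0 ?sqr_ge0.
have K0 : 0 < K by exact: lt_le_trans K1.
pose C := C0 + C1 + 1.
have C_0 : 0 < C by rewrite /C; lra.
exists C, K; split => // n s sdM.
have s0 : 0 < s by case/andP: sdM => + _; exact: lt_le_trans.
suff : `|g n s| <= C * K ^+ n * n`!%:R /\ `|g n.+1 s| <= C * K ^+ n.+1 * n.+1`!%:R.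
  by case.
elim: n => [|n [IH1 IH2]].
  split.
    by rewrite expr0 fact0 !mulr1 (le_trans (H0 _ sdM)) // /C; lra.
  rewrite expr1 factS fact0 muln1 mulr1 (le_trans (H1 _ sdM)) //.
  by rewrite (@le_trans _ _ C) ?ler_peMr // ?(ltW C_0) // /C; lra.
split => //.
have s1 : s != 0 by rewrite gt_eqF.
have -> : g n.+2 s = - ((4 * n%:R + 2 * N%:R) * g n.+1 s + k ^+ 2 * g n s) / (4 * s).
  have := radial_ode rg n s s0 => E.
  apply: (@mulfI _ (4 * s)); first by rewrite mulf_neq0.
  rewrite mulrCA divff ?mulr1; last by rewrite mulf_neq0.
  by rewrite -[LHS]subr0 -E; ring.
rewrite normrM normfV ler_pdivrMr ?normr_gt0 ?mulf_neq0 //.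
rewrite normrN (gtr0_norm (_ : 0 < 4 * s)) ?mulr_gt0 //.
have ds : d <= s by case/andP: sdM.
set F : R := n`!%:R in IH1 *.
have F0 : 0 <= F by [].
have n0 : 0 <= n%:R :> R by [].
have N0 : 0 <= N%:R :> R by [].
have F1 : n.+1`!%:R = (n%:R + 1) * F :> R by rewrite factS natrM -natr1.
have F2 : n.+2`!%:R = (n%:R + 2) * ((n%:R + 1) * F) :> R.
  by rewrite factS natrM F1 -[n.+2%:R]natr1 -natr1; ring.
rewrite F2; rewrite F1 in IH2.
set P := C * K ^+ n * F.
have P0 : 0 <= P by rewrite mulr_ge0 // mulr_ge0 ?exprn_ge0 // ltW.
have {}IH1 : `|g n s| <= P by [].
have {}IH2 : `|g n.+1 s| <= K * (n%:R + 1) * P.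
  by apply: le_trans IH2 _; rewrite exprS /P le_eqVlt; apply/orP; left; apply/eqP; ring.
have -> : C * K ^+ n.+2 * ((n%:R + 2) * ((n%:R + 1) * F)) * (4 * s)
    = P * K ^+ 2 * (n%:R + 2) * (n%:R + 1) * 4 * s.
  by rewrite !exprS /P expr0; ring.
clearbody P.
apply: le_trans (ler_normD _ _) _.
rewrite (normrM (4 * n%:R + 2 * N%:R)) (normrM (k ^+ 2)).
rewrite (ger0_norm (_ : 0 <= 4 * n%:R + 2 * N%:R)) ?addr_ge0 ?mulr_ge0 //.
rewrite (ger0_norm (sqr_ge0 k)).
have k20 := sqr_ge0 k.
apply: (@le_trans _ _ ((4 * n%:R + 2 * N%:R) * (K * (n%:R + 1) * P) + k ^+ 2 * P)).
  by apply: lerD; apply: ler_wpM2l => //; rewrite addr_ge0 ?mulr_ge0.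
have Kd : (4 + 2 * N%:R + k ^+ 2) <= K * s.
  apply: (@le_trans _ _ (K * d)); last by rewrite ler_pM2l.
  have d1 : d != 0 by rewrite gt_eqF.
  have -> : K * d = d + (4 + 2 * N%:R + k ^+ 2) by rewrite /K; field.
  by rewrite lerDr ltW.
have : (4 + 2 * N%:R + k ^+ 2) * (K * P * (n%:R + 2) * (n%:R + 1) * 4) <=
       K * s * (K * P * (n%:R + 2) * (n%:R + 1) * 4).
  have KP : 0 <= K * P by rewrite mulr_ge0 // ltW.
  have n1 : 0 <= n%:R + 1 :> R by rewrite addr_ge0.
  have n2 : 0 <= n%:R + 2 :> R by rewrite addr_ge0.
  apply: ler_wpM2r; last exact: Kd.
  by apply: mulr_ge0 => //; apply: mulr_ge0 => //; apply: mulr_ge0.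
have -> : K * s * (K * P * (n%:R + 2) * (n%:R + 1) * 4) =
  P * K ^+ 2 * (n%:R + 2) * (n%:R + 1) * 4 * s by ring.
apply: le_trans.
have KP : P <= K * P by rewrite ler_peMl.
have : k ^+ 2 * P <= k ^+ 2 * (K * P) by rewrite ler_wpM2l.
have KP0 : 0 <= K * P by exact: le_trans KP.
set Q := K * P in KP KP0 *.
have -> : (4 * n%:R + 2 * N%:R) * (K * (n%:R + 1) * P) = (4 * n%:R + 2 * N%:R) * (n%:R + 1) * Q.
  by rewrite /Q; ring.
move=> H; apply: le_trans (lerD (lexx _) H) _.
set m : R := n%:R in n0 *; set N' : R := N%:R in N0 *.
rewrite -subr_ge0.
have -> : (4 + 2 * N' + k ^+ 2) * (Q * (m + 2) * (m + 1) * 4) -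
  ((4 * m + 2 * N') * (m + 1) * Q + k ^+ 2 * Q) =
  Q * ((12 * m + 32 + 8 * N' * m + 14 * N') * (m + 1) + k ^+ 2 * (4 * (m + 2) * (m + 1) - 1)) by ring.
apply: mulr_ge0 => //; apply: addr_ge0; apply: mulr_ge0 => //.
- by rewrite !addr_ge0 ?mulr_ge0.
- by rewrite addr_ge0.
- by nra.
Qed.

(** The mean value theorem costs a factor [m] compared with the integral form of the remainder; the
    2 in [2 * K] pays for it, through [m <= 2 ^ m]. *)
Lemma radial_taylor g d M (C K : R) : radial N k g -> 0 < d -> 0 <= C -> 0 <= K ->
  (forall n s, d <= s <= M -> `|g n s| <= C * K ^+ n * n`!%:R) ->
  forall m s x, d <= s <= M -> d <= x <= M ->
  `|g 0%N x - \sum_(n < m) g n s / n`!%:R * (x - s) ^+ n| <= C * (2 * K * `|x - s|) ^+ m.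
Proof.
move=> rg d0 C0 K0 H m s x sdM xdM.
case: m => [|m].
  by rewrite big_ord0 subr0 expr0 mulr1 (le_trans (H _ _ xdM)) // expr0 fact0 !mulr1.
(* The Taylor polynomial at [x] as a function of its centre [t]. Its derivative telescopes to the
   single term [dpsi], and at [t = x] it equals [g 0 x]. *)
pose psi t := \sum_(n < m.+1) (g n t / n`!%:R * (x - t) ^+ n).
pose dpsi t := g m.+1 t / m`!%:R * (x - t) ^+ m.
have D t : Num.min s x <= t <= Num.max s x -> d <= t <= M.
  rewrite ge_min le_max; case/andP: sdM => ? ?; case/andP: xdM => ? ?.
  by case/andP => /orP[?|?] /orP[?|?]; apply/andP; split; lra.
have fneq n : n`!%:R != 0 :> R by rewrite pnatr_eq0 -lt0n fact_gt0.
have Dpsi (t : R) : 0 < t -> is_derive t (1:R) psi (dpsi t).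
  move=> t0; rewrite /psi /dpsi {psi dpsi}.
  elim: m => [|m IH].
    apply: der_eq (radial_derive rg 0 _ t0) _ _ => [u|].
      by rewrite big_ord_recl big_ord0 expr0 fact0 mulr1 divr1 addr0.
    by rewrite expr0 fact0 divr1 mulr1.
  apply: der_eq (derD IH (derM (derM (radial_derive rg m.+1 _ t0) (derC _ _))
    (derXn m.+1 (derD (derC x t) (derN (is_derive_id t 1)))))) _ _ => [u|].
    by rewrite [RHS]big_ord_recr.
  rewrite /= mulr0 addr0 add0r factS natrM.
  have : m.+1%:R != 0 :> R by [].
  by move: (fneq m) => ? ?; field; apply/andP.
have := @mean_value_le _ psi dpsi s x (C * K ^+ m.+1 * m.+1%:R * `|x - s| ^+ m) _ _.
have -> : psi x = g 0%N x.
  rewrite /psi big_ord_recl big1 ?addr0 => [|i _]; last first.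
    by rewrite subrr expr0n /= mulr0.
  by rewrite expr0 fact0 divr1 mulr1.
move=> HH; apply: le_trans (HH _ _) _.
- move=> t /D /andP[dt _]; apply: Dpsi; exact: lt_le_trans dt.
- move=> t tt; have := D _ tt => tdM.
  rewrite /dpsi !normrM normfV normrX (ger0_norm (_ : 0 <= m`!%:R)) //.
  apply: ler_pM; rewrite ?mulr_ge0 ?exprn_ge0 ?invr_ge0 //.
    rewrite ler_pdivrMr ?ltr0n ?fact_gt0 // (le_trans (H _ _ tdM)) //.
    by rewrite -[leRHS]mulrA -natrM -factS.
  apply: lerXn2r; rewrite ?nnegrE //.
  move: tt; rewrite ge_min le_max => /andP[/orP[?|?] /orP[?|?]];
  rewrite ler_norml; have := ler_norm (x - s); have := ler_norm (s - x); rewrite (distrC s);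
  move=> ? ?; apply/andP; split; lra.
rewrite -!mulrA -exprSr ler_wpM2l //.
rewrite !exprMn [leRHS]mulrCA.
apply: ler_wpM2l; first exact: exprn_ge0.
apply: ler_wpM2r; first exact: exprn_ge0.
by rewrite -natrX ler_nat ltnW // ltn_expl.
Qed.

End RadialChain.

(** * Power series along a line *)

Section LineExpansion.
Context {R : realType}.
Implicit Types (A B H K al be tau rho : R) (b : nat -> R).

Definition binom_term al be (n j : nat) : R := al ^+ (n - j) * be ^+ j * 'C(n, j)%:R.

(** Coefficient of [tau ^ m] in the sum of the [b n * (al * tau + be * tau ^ 2) ^ n]: the n-th
    summand contains [tau ^ n * (al + be * tau) ^ n], so the binomial index is [m - n]. If
    [m - n > n], the truncated exponent is harmless because the binomial coefficient is 0. *)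
Definition line_coef b al be (m : nat) : R :=
  \sum_(n < m.+1) b n * binom_term al be n (m - n).

Lemma triangle_sum (F : nat -> nat -> R) (M : nat) :
  \sum_(m < M) \sum_(n < m.+1) F n (m - n)%N = \sum_(n < M) \sum_(j < M - n) F n j.
Proof.
elim: M => [|M IH]; first by rewrite !big_ord0.
rewrite big_ord_recr /= IH [in RHS]big_ord_recr /= subSnn big_ord1.
rewrite [X in _ + X]big_ord_recr /= subnn addrA; congr (_ + _).
by rewrite -big_split /=; apply: eq_bigr => i _; rewrite subSn 1?ltnW // big_ord_recr.
Qed.

Lemma binomial_expand al be tau n M : (n < M)%N ->
  (al + be * tau) ^+ n = \sum_(j < M) binom_term al be n j * tau ^+ j.
Proof.
move=> nM; rewrite exprDn.
rewrite -(big_mkord xpredT (fun i => al ^+ (n - i) * (be * tau) ^+ i *+ 'C(n, i))).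
rewrite -(big_mkord xpredT (fun j => binom_term al be n j * tau ^+ j)).
rewrite [RHS](big_cat_nat (n := n.+1)) //= [X in _ = _ + X]big_nat_cond [X in _ = _ + X]big1 ?addr0.
  by apply: eq_bigr => i _; rewrite /binom_term exprMn -mulr_natr; ring.
move=> i /andP[/andP[ni _] _].
by rewrite /binom_term bin_small // mulr0 mul0r.
Qed.

Lemma binom_term_norm al be A B n j : `|al| <= A -> `|be| <= B ->
  `|binom_term al be n j| <= binom_term A B n j.
Proof.
move=> aA bB; rewrite /binom_term !normrM !normrX (ger0_norm (_ : 0 <= 'C(n, j)%:R)) //.
apply: ler_wpM2r => //; apply: ler_pM; rewrite ?exprn_ge0 //.
  by apply: lerXn2r; rewrite ?nnegrE //; exact: le_trans aA.
by apply: lerXn2r; rewrite ?nnegrE //; exact: le_trans bB.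
Qed.

Lemma binom_term_ge0 A B n j : 0 <= A -> 0 <= B -> 0 <= binom_term A B n j.
Proof. by move=> A0 B0; rewrite /binom_term !mulr_ge0 ?exprn_ge0. Qed.

Lemma half_geo_sum (z : R) M : 0 <= z -> z <= 2^-1 -> \sum_(n < M) z ^+ n <= 2.
Proof.
move=> z0 z2; suff : \sum_(n < M) z ^+ n <= 2 - 2 * z ^+ M.
  by move=> /le_trans; apply; rewrite gerBl mulr_ge0 ?exprn_ge0.
elim: M => [|M IH]; first by rewrite big_ord0 expr0 mulr1 subrr.
rewrite big_ord_recr /= (le_trans (lerD IH (lexx _))) // exprS.
have := exprn_ge0 M z0; move: (z ^+ M) => w w0; nra.
Qed.

(* Rearranging a series in [al * tau + be * tau ^ 2] into one in [tau]: the tails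
   are dominated by those of the majorant series in [A * rho + B * rho ^ 2]. *)
Lemma line_expansion b al be A B H K rho tau (f : R) :
  0 <= H -> 0 <= K -> 0 < rho -> `|al| <= A -> `|be| <= B ->
  2 * K * (A * rho + B * rho ^+ 2) <= 2^-1 ->
  (forall n, `|b n| <= H * K ^+ n) ->
  (forall m, `|f - \sum_(n < m) b n * (al * tau + be * tau ^+ 2) ^+ n|
     <= H * (2 * K * `|al * tau + be * tau ^+ 2|) ^+ m) ->
  `|tau| <= rho ->
  forall M, `|f - \sum_(m < M) line_coef b al be m * tau ^+ m|
     <= 3 * H * (`|tau| / rho) ^+ M.
Proof.
move=> H0 K0 rho0 alA beB small bH fH taurho M.
have A0 : 0 <= A by exact: le_trans alA.
have B0 : 0 <= B by exact: le_trans beB.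
have rho1 : rho != 0 by rewrite gt_eqF.
set h := al * tau + be * tau ^+ 2 in fH *.
set x := `|tau| / rho.
have x0 : 0 <= x by rewrite divr_ge0 // ltW.
have x1 : x <= 1 by rewrite ler_pdivrMr // mul1r.
have taux : `|tau| = rho * x by rewrite /x mulrCA divff // mulr1.
have hx : 2 * K * `|h| <= x.
  have h1 : `|h| <= A * `|tau| + B * `|tau| ^+ 2.
    rewrite (le_trans (ler_normD _ _)) // (normrM al) (normrM be) normrX.
    by apply: lerD; apply: ler_wpM2r => //; rewrite exprn_ge0.
  have h2 : `|h| <= (A * rho + B * rho ^+ 2) * x.
    apply: le_trans h1 _; rewrite taux exprMn.
    have xx : x ^+ 2 <= x by rewrite expr2 ler_piMl.
    have : B * rho ^+ 2 * x ^+ 2 <= B * rho ^+ 2 * x.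
      by apply: ler_wpM2l => //; rewrite mulr_ge0 // exprn_ge0 // ltW.
    by lra.
  have : 2 * K * `|h| <= 2 * K * ((A * rho + B * rho ^+ 2) * x).
    by apply: ler_wpM2l => //; rewrite mulr_ge0.
  move=> /le_trans; apply; rewrite mulrA.
  apply: le_trans (ler_wpM2r x0 small) _; lra.
(* One share for the remainder of the series in [h], two for the rearrangement of its partial
   sum. *)
have -> : 3 * H * x ^+ M = H * x ^+ M + 2 * H * x ^+ M by ring.
rewrite -[f](subrK (\sum_(n < M) b n * h ^+ n)) -addrA.
apply: le_trans (ler_normD _ _) _; apply: lerD.
  apply: le_trans (fH M) _; apply: ler_wpM2l => //.
  by apply: lerXn2r => //; rewrite nnegrE // mulr_ge0 // mulr_ge0.
pose F n j := b n * binom_term al be n j * tau ^+ (n + j).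
have -> : \sum_(m < M) line_coef b al be m * tau ^+ m = \sum_(n < M) \sum_(j < M - n) F n j.
  rewrite -triangle_sum; apply: eq_bigr => m _; rewrite /line_coef mulr_suml.
  by apply: eq_bigr => n _; rewrite /F subnKC // -ltnS.
have -> : \sum_(n < M) b n * h ^+ n = \sum_(n < M) \sum_(j < M) F n j.
  apply: eq_bigr => n _.
  have -> : h = tau * (al + be * tau) by rewrite /h; ring.
  rewrite exprMn (binomial_expand _ _ _ (ltn_ord n)) !mulr_sumr.
  by apply: eq_bigr => j _; rewrite /F exprD; ring.
rewrite -sumrB (le_trans (ler_norm_sum _ _ _)) //.
have geo : \sum_(n < M) (K * (A * rho + B * rho ^+ 2)) ^+ n <= 2.
  apply: half_geo_sum.
    by rewrite mulr_ge0 // addr_ge0 // mulr_ge0 ?exprn_ge0 // ltW.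
  have : 0 <= K * (A * rho + B * rho ^+ 2).
    by rewrite mulr_ge0 // addr_ge0 // mulr_ge0 ?exprn_ge0 // ltW.
  move: small; rewrite -mulrA; lra.
have : (H * x ^+ M) * \sum_(n < M) (K * (A * rho + B * rho ^+ 2)) ^+ n <= 2 * H * x ^+ M.
  have HxM : 0 <= H * x ^+ M by rewrite mulr_ge0 // exprn_ge0.
  by apply: le_trans (ler_wpM2l HxM geo) _; rewrite mulrC mulrA.
apply: le_trans; rewrite mulr_sumr; apply: ler_sum => -[n nM] _ /=.
rewrite -(big_mkord xpredT (F n)) -(big_mkord xpredT (F n)).
(* The difference consists of the terms with [n < M <= n + j]: their total degree in [tau] is at
   least [M], so each of them yields a factor [x ^ M]. *)
rewrite (big_cat_nat (n := (M - n)%N)) //= ?leq_subr // addrAC subrr add0r.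
apply: le_trans (ler_norm_sum _ _ _) _.
pose G j := H * K ^+ n * binom_term A B n j * rho ^+ (n + j) * x ^+ M.
have G0 j : 0 <= G j.
  rewrite /G; apply: mulr_ge0; last exact: exprn_ge0.
  apply: mulr_ge0; last by rewrite exprn_ge0 // ltW.
  by apply: mulr_ge0; [rewrite mulr_ge0 // exprn_ge0|exact: binom_term_ge0].
apply: (@le_trans _ _ (\sum_(M - n <= j < M) G j)).
  rewrite big_nat_cond [leRHS]big_nat_cond; apply: ler_sum => j /andP[/andP[Mj _] _].
  rewrite /F normrM (normrM (b n)) normrX taux exprMn /G -mulrA -[leRHS]mulrA -[leRHS]mulrA.
  rewrite -[leRHS]mulrA [leRHS]mulrA.
  apply: ler_pM => //; first by rewrite mulr_ge0 // mulr_ge0 ?exprn_ge0 // ltW.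
  apply: ler_pM => //; first by rewrite mulr_ge0 ?exprn_ge0 // ltW.
    exact: binom_term_norm.
  apply: ler_wpM2l; first by rewrite exprn_ge0 // ltW.
  by apply: ler_wiXn2l => //; rewrite -leq_subLR.
apply: (@le_trans _ _ (\sum_(0 <= j < M) G j)).
  by rewrite [leRHS](big_cat_nat (n := (M - n)%N)) //= ?leq_subr // lerDr sumr_ge0.
rewrite /G big_mkord -mulr_suml.
have -> : \sum_(j < M) H * K ^+ n * binom_term A B n j * rho ^+ (n + j) =
    H * K ^+ n * rho ^+ n * \sum_(j < M) binom_term A B n j * rho ^+ j.
  by rewrite mulr_sumr; apply: eq_bigr => j _; rewrite exprD; ring.
rewrite -binomial_expand // le_eqVlt; apply/orP; left; apply/eqP.
have -> : A * rho + B * rho ^+ 2 = rho * (A + B * rho) by ring.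
by rewrite !exprMn; ring.
Qed.

(** Identity principle with the analyticity of [phi] encoded in the remainder bound. Once the lower
    coefficients vanish, the bound at order [m.+1] reads [|c m| <= D * t] for small [t]; once all
    vanish, [phi] is below a geometric sequence on the whole interval, not just near 0. *)
Lemma power_identity (phi : R -> R) (c : nat -> R) (C rho eps : R) :
  0 < rho -> 0 < eps ->
  (forall M tau, `|tau| <= rho ->
     `|phi tau - \sum_(m < M) c m * tau ^+ m| <= C * (`|tau| / rho) ^+ M) ->
  (forall tau, `|tau| < eps -> phi tau = 0) ->
  (forall m, c m = 0) /\ (forall tau, `|tau| < rho -> phi tau = 0).
Proof.
move=> rho0 eps0 phic phi0.
have rho1 : rho != 0 by rewrite gt_eqF.
have C0 : 0 <= C.
  by have := phic 0%N 0 _; rewrite big_ord0 subr0 normr0 expr0 mulr1 phi0 ?normr0 //; apply; exact: ltW.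
have c0 m : c m = 0.
  elim/ltn_ind: m => m IH; apply/eqP; rewrite -normr_le0.
  apply/ler_addgt0Pl => e e0; rewrite addr0.
  pose D := C / rho ^+ m.+1.
  have D0 : 0 <= D by rewrite divr_ge0 // exprn_ge0 // ltW.
  (* Inside both intervals and with [t * D <= e]; the denominator is [D + 1] because [D] may be
     0. *)
  pose t := Num.min (Num.min (rho / 2) (eps / 2)) (e / (D + 1)).
  have t0 : 0 < t.
    by rewrite !lt_min; apply/andP; split; [apply/andP; split; lra|rewrite divr_gt0 // ltr_wpDl].
  have trho : t < rho by rewrite /t !gt_min; apply/orP; left; apply/orP; left; lra.
  have teps : t < eps by rewrite /t !gt_min; apply/orP; left; apply/orP; right; lra.
  have te : t * D <= e.
    have : t <= e / (D + 1) by rewrite /t ge_min lexx orbT.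
    rewrite ler_pdivlMr ?ltr_wpDl // => /(le_trans _); apply.
    by rewrite ler_pM2l // lerDl.
  have phit : phi t = 0 by apply: phi0; rewrite gtr0_norm.
  have ct : \sum_(i < m.+1) c i * t ^+ i = c m * t ^+ m.
    by rewrite big_ord_recr /= big1 ?add0r // => i _; rewrite IH // mul0r.
  have := phic m.+1 t; rewrite phit ct sub0r (gtr0_norm t0) => /(_ (ltW trho)).
  rewrite normrN normrM normrX (gtr0_norm t0).
  have -> : C * (t / rho) ^+ m.+1 = D * t * t ^+ m.
    by rewrite expr_div_n /D (exprS t); ring.
  rewrite ler_pM2r ?exprn_gt0 // mulrC => /le_trans; exact.
split=> // tau taurho.
have x1 : `|tau| / rho < 1 by rewrite ltr_pdivrMr // mul1r.
have x0 : 0 <= `|tau| / rho by rewrite divr_ge0 // ltW.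
apply/eqP; rewrite -normr_le0.
have lim0 : (fun M => C * (`|tau| / rho) ^+ M) @ \oo --> (0 : R).
  by apply: cvg_geometric; rewrite ger0_norm.
apply: cvgr_to_ge lim0 _; apply: nearW => M.
have := phic M tau (ltW taurho); rewrite big1 ?subr0 // => i _.
by rewrite c0 mul0r.
Qed.

End LineExpansion.

(** * Wronskian, Euclidean geometry and real integrals *)

Section RadialWronskian.
Context {R : realType} (N : nat) (k : R).

(** Write [W n = A n * B n.+1 - A n.+1 * B n] at [s]. Eliminating the middle term between the two
    recursions gives [4 s * W n.+1 = k ^ 2 * W n], and a common zero of [A n] and [B n] would make
    [W n] vanish. *)
Lemma radial_nonzero (A B : nat -> R -> R) (s : R) :
  radial N k A -> radial N k B -> k != 0 -> 0 < s ->
  A 0%N s * B 1%N s - A 1%N s * B 0%N s != 0 ->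
  forall n, A n s ^+ 2 + B n s ^+ 2 != 0.
Proof.
move=> rA rB k0 s0 W0 n.
have s1 : s != 0 by rewrite gt_eqF.
have : A n s * B n.+1 s - A n.+1 s * B n s != 0.
  elim: n => // n IH.
  have := radial_ode rA n s s0; have := radial_ode rB n s s0.
  set c := 4 * n%:R + 2 * N%:R => EB EA.
  have : 4 * s * (A n.+1 s * B n.+2 s - A n.+2 s * B n.+1 s)
      = k ^+ 2 * (A n s * B n.+1 s - A n.+1 s * B n s).
    apply/eqP; rewrite -subr_eq0; apply/eqP.
    transitivity (A n.+1 s * (4 * s * B n.+2 s + c * B n.+1 s + k ^+ 2 * B n s)
      - B n.+1 s * (4 * s * A n.+2 s + c * A n.+1 s + k ^+ 2 * A n s)); first ring.
    by rewrite EA EB !mulr0 subrr.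
  move=> E; apply/eqP => E0; move: E; rewrite E0 mulr0 => /esym/eqP.
  by rewrite mulf_eq0 (negbTE IH) orbF expf_eq0 (negbTE k0) andbF.
apply: contra; rewrite paddr_eq0 ?sqr_ge0 // !sqrf_eq0 => /andP[/eqP-> /eqP->].
by rewrite mul0r mulr0 subrr.
Qed.

End RadialWronskian.

Section EuclideanGeometry.
Context {R : realType} {N : nat}.
Implicit Types (x y v : 'rV[R]_N) (a b t : R).

Definition dotp x y : R := \sum_(i < N) x ord0 i * y ord0 i.
Definition sqn x : R := \sum_(i < N) x ord0 i ^+ 2.

Lemma sqn_ge0 x : 0 <= sqn x.
Proof. by apply: sumr_ge0 => i _; exact: sqr_ge0. Qed.

Lemma sqn_line x v y t :
  sqn (x + t *: v - y) = sqn (x - y) + (2 * dotp v (x - y) * t + sqn v * t ^+ 2).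
Proof.
rewrite /sqn /dotp mulr_sumr !mulr_suml -!big_split /=.
by apply: eq_bigr => i _; rewrite !mxE; ring.
Qed.

Lemma sqnZ a x : sqn (a *: x) = a ^+ 2 * sqn x.
Proof. by rewrite /sqn mulr_sumr; apply: eq_bigr => i _; rewrite mxE exprMn. Qed.

Lemma sqnN x : sqn (- x) = sqn x.
Proof. by rewrite -scaleN1r sqnZ sqrrN expr1n mul1r. Qed.

Lemma sqnB x y : sqn (x - y) = sqn x - 2 * dotp x y + sqn y.
Proof.
rewrite /sqn /dotp mulr_sumr -sumrB -big_split /=.
by apply: eq_bigr => i _; rewrite !mxE; ring.
Qed.

Lemma dotpZl a x y : dotp (a *: x) y = a * dotp x y.
Proof. by rewrite /dotp mulr_sumr; apply: eq_bigr => i _; rewrite mxE mulrA. Qed.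

Lemma dotpNr x y : dotp x (- y) = - dotp x y.
Proof. by rewrite /dotp -sumrN; apply: eq_bigr => i _; rewrite mxE mulrN. Qed.

Lemma dotpC x y : dotp x y = dotp y x.
Proof. by apply: eq_bigr => i _; rewrite mulrC. Qed.

Lemma dotpBr v x y : dotp v (x - y) = dotp v x - dotp v y.
Proof. by rewrite /dotp -sumrB; apply: eq_bigr => i _; rewrite !mxE mulrBr. Qed.

Lemma sqn0_dotp x y : sqn x = 0 -> dotp x y = 0.
Proof.
move=> x0; rewrite /dotp big1 // => i _.
have /psumr_eq0P : \sum_(j < N) x ord0 j ^+ 2 = 0 by [].
move=> /(_ (fun j _ => sqr_ge0 _) i isT) /eqP; rewrite sqrf_eq0 => /eqP ->.
by rewrite mul0r.
Qed.

(** Stated with bounds [a] and [b] rather than norms, which avoids square roots. The squared norms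
    of [b x - a y] and [b x + a y] are nonnegative, which gives the two signs after division by
    [a * b]; hence the separate treatment of zero bounds. *)
Lemma cauchy_schwarz x y a b : 0 <= a -> 0 <= b ->
  sqn x <= a ^+ 2 -> sqn y <= b ^+ 2 -> `|dotp x y| <= a * b.
Proof.
move=> a0 b0 xa yb.
have [az|anz] := eqVneq a 0.
  rewrite sqn0_dotp ?normr0 ?mulr_ge0 //.
  by apply/eqP; rewrite eq_le sqn_ge0 andbT; move: xa; rewrite az expr0n.
have [bz|bnz] := eqVneq b 0.
  rewrite dotpC sqn0_dotp ?normr0 ?mulr_ge0 //.
  by apply/eqP; rewrite eq_le sqn_ge0 andbT; move: yb; rewrite bz expr0n.
have ab0 : 0 < a * b by rewrite mulr_gt0 // lt0r ?anz ?bnz.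
have E c : sqn (b *: x - (c * a) *: y) =
    b ^+ 2 * sqn x - 2 * c * (a * b) * dotp x y + c ^+ 2 * a ^+ 2 * sqn y.
  by rewrite sqnB !sqnZ dotpZl (dotpC x) dotpZl (dotpC y); ring.
have := sqn_ge0 (b *: x - (1 * a) *: y); have := sqn_ge0 (b *: x - (-1 * a) *: y).
rewrite !E => H1 H2.
have Hx : b ^+ 2 * sqn x <= b ^+ 2 * a ^+ 2 by rewrite ler_wpM2l ?sqr_ge0.
have Hy : a ^+ 2 * sqn y <= a ^+ 2 * b ^+ 2 by rewrite ler_wpM2l ?sqr_ge0.
rewrite ler_norml; apply/andP; split; rewrite -(ler_pM2l ab0); nra.
Qed.

Lemma sqn_add_lt x v t b : sqn x < b ^+ 2 -> 0 < b -> sqn v <= 1 ->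
  `|t| < b - Num.sqrt (sqn x) -> sqn (x + t *: v) < b ^+ 2.
Proof.
move=> xb b0 v1 tb; set a := Num.sqrt (sqn x) in tb *.
have a0 : 0 <= a by exact: sqrtr_ge0.
have aE : sqn x = a ^+ 2 by rewrite sqr_sqrtr ?sqn_ge0.
rewrite -[x + _]subr0 sqn_line subr0.
have : `|dotp v x| <= 1 * a by apply: cauchy_schwarz; rewrite ?aE ?expr1n.
rewrite mul1r => Hd.
have H1 : sqn v * t ^+ 2 <= `|t| ^+ 2.
  by rewrite real_normK ?num_real // ler_piMl ?sqr_ge0.
have H2 : 2 * dotp v x * t <= 2 * a * `|t|.
  apply: le_trans (ler_norm _) _; rewrite normrM normrM ger0_norm //.
  by rewrite -!mulrA ler_wpM2l // ler_wpM2r.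
have t0 := normr_ge0 t.
have : (a + `|t|) ^+ 2 < b ^+ 2.
  by rewrite ltrXn2r // ?nnegrE ?addr_ge0 ?(ltW b0) //; lra.
rewrite aE; nra.
Qed.

(** Keeps the argument of the kernel in a compact interval of positive reals, uniformly for [x] in a
    smaller ball; this is where [radial_bound] applies. *)
Lemma dist_bounds x y (r0 r : R) : 0 <= r0 -> r0 < r -> sqn x <= r0 ^+ 2 ->
  sqn y = r ^+ 2 -> (r - r0) ^+ 2 <= sqn (x - y) <= (r + r0) ^+ 2.
Proof.
move=> r00 r0r xr yr; set a := Num.sqrt (sqn x).
have a0 : 0 <= a by exact: sqrtr_ge0.
have aE : sqn x = a ^+ 2 by rewrite sqr_sqrtr ?sqn_ge0.
have ar : a <= r0 by rewrite -(ler_pXn2r (n := 2)) ?nnegrE // -aE.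
have r_0 : 0 <= r by lra.
have := cauchy_schwarz a0 r_0 (_ : sqn x <= a ^+ 2) (_ : sqn y <= r ^+ 2).
rewrite aE yr lexx => /(_ isT (lexx _)); rewrite ler_norml => /andP[H1 H2].
by rewrite sqnB aE yr; apply/andP; split; nra.
Qed.

End EuclideanGeometry.

Section RealIntegral.
Context d (T : measurableType d) {R : realType} (mu : {measure set T -> \bar R}).
Context (D : set T) (mD : measurable D).
Implicit Types (f g h : T -> R).

Definition rintegrable f := mu.-integrable D (EFin \o f).

Lemma rintegrable_measurable f : rintegrable f -> measurable_fun D f.
Proof. by move=> /measurable_int/measurable_EFinP. Qed.

Lemma rintegrable_le f g : measurable_fun D f ->
  (forall t, D t -> `|f t| <= g t) -> rintegrable g -> rintegrable f.
Proof.
move=> mf fg; apply: le_integrable => //; first exact/measurable_EFinP.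
by move=> t Dt; rewrite /= lee_fin (le_trans (fg t Dt)) // ler_norm.
Qed.

Lemma rintegrableD f g : rintegrable f -> rintegrable g ->
  rintegrable (fun t => f t + g t).
Proof. by move=> F G; exact: (integrableD mD F G). Qed.

Lemma rintegrableZ c f : rintegrable f -> rintegrable (fun t => c * f t).
Proof. by move=> F; exact: (integrableZl mD c F). Qed.

Lemma rintegrableN f : rintegrable f -> rintegrable (fun t => - f t).
Proof. by move=> F; exact: (integrableN F). Qed.

Lemma rintegrableB f g : rintegrable f -> rintegrable g ->
  rintegrable (fun t => f t - g t).
Proof. by move=> F G; exact: (integrableB mD F G). Qed.

Lemma rintegrable_abs f : rintegrable f -> rintegrable (fun t => `|f t|).
Proof. by move=> F; exact: (integrable_norm F). Qed.

Lemma rintegrable_eq f g : (forall t, D t -> f t = g t) -> rintegrable f -> rintegrable g.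
Proof.
by move=> fg; apply: eq_integrable => // t; rewrite inE => Dt; rewrite /= fg.
Qed.

Lemma rintegrable0 : rintegrable (fun=> 0).
Proof. exact: integrable0. Qed.

Lemma rintegrable_sum n (F : nat -> T -> R) : (forall i, (i < n)%N -> rintegrable (F i)) ->
  rintegrable (fun t => \sum_(i < n) F i t).
Proof.
elim: n => [|n IH] H.
  by apply: rintegrable_eq rintegrable0 => t _; rewrite big_ord0.
apply: (@rintegrable_eq (fun t => \sum_(i < n) F i t + F n t)).
  by move=> t _; rewrite big_ord_recr.
by apply: rintegrableD; [apply: IH => i ilt; apply: H; exact: ltnW|exact: H].
Qed.

Lemma rintegrable_mul_bounded f h (C : R) : rintegrable f -> measurable_fun D h ->
  (forall t, D t -> `|h t| <= C) -> rintegrable (fun t => f t * h t).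
Proof.
move=> F mh hC.
apply: (@rintegrable_le _ (fun t => C * `|f t|)); last exact/rintegrableZ/rintegrable_abs.
  by apply: measurable_funM => //; exact: rintegrable_measurable.
by move=> t Dt; rewrite normrM mulrC ler_wpM2r // hC.
Qed.

Lemma Rintegral_eq f g : (forall t, D t -> f t = g t) ->
  \int[mu]_(t in D) f t = \int[mu]_(t in D) g t.
Proof. by move=> fg; apply: eq_Rintegral => t; rewrite inE => /fg. Qed.

Lemma Rintegral_eq0 f : (forall t, D t -> f t = 0) -> \int[mu]_(t in D) f t = 0.
Proof. by move=> f0; rewrite (Rintegral_eq f0) Rintegral_cst // mul0r. Qed.

Lemma Rintegral_sum n (F : nat -> T -> R) : (forall i, (i < n)%N -> rintegrable (F i)) ->
  \int[mu]_(t in D) (\sum_(i < n) F i t) = \sum_(i < n) \int[mu]_(t in D) F i t.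
Proof.
elim: n => [|n IH] H.
  by rewrite big_ord0; apply: Rintegral_eq0 => t _; rewrite big_ord0.
rewrite (Rintegral_eq (g := fun t => \sum_(i < n) F i t + F n t)); last first.
  by move=> t _; rewrite big_ord_recr.
rewrite RintegralD //.
- by rewrite IH ?big_ord_recr // => i ilt; apply: H; exact: ltnW.
- by apply: rintegrable_sum => i ilt; apply: H; exact: ltnW.
- exact: H.
Qed.

End RealIntegral.

(** * Expansion and continuation of potentials *)

Section Potential.
Context d (T : measurableType d) {R : realType} (mu : {measure set T -> \bar R}).
Context (D : set T) (mD : measurable D) (N : nat) (y : T -> 'rV[R]_N) (r k : R).
Context (my : forall i, measurable_fun D (fun t => y t ord0 i)).
Context (r0 : 0 < r) (yr : forall t, D t -> sqn (y t) = r ^+ 2).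
Context (A B : nat -> R -> R) (rA : radial N k A) (rB : radial N k B).
Implicit Types (P Q : T -> R) (x v : 'rV[R]_N) (tau : R).

Local Notation L1 := (rintegrable mu D).

Definition potential P Q x : R :=
  \int[mu]_(t in D) (P t * A 0%N (sqn (x - y t)) + Q t * B 0%N (sqn (x - y t))).

Definition taylor_density P Q x t (n : nat) : R :=
  (P t * A n (sqn (x - y t)) + Q t * B n (sqn (x - y t))) / n`!%:R.

(** Coefficient of [tau ^ m] of the potential at [x + tau *: v]: the integrand is expanded along the
    line by [line_coef], using [sqn_line] for the increment of the squared distance, and then
    integrated. *)
Definition potential_coef P Q x v (m : nat) : R :=
  \int[mu]_(t in D)
    line_coef (taylor_density P Q x t) (2 * dotp v (x - y t)) (sqn v) m.

Lemma measurable_dotp v : measurable_fun D (fun t => dotp v (y t)).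
Proof.
by apply: measurable_sum => i; apply: measurable_funM.
Qed.

Lemma measurable_dist x : measurable_fun D (fun t => sqn (x - y t)).
Proof.
apply: measurable_sum => i; apply: measurable_funX.
apply: (eq_measurable_fun (fun t => x ord0 i - y t ord0 i)).
  by move=> t _; rewrite !mxE.
exact: measurable_funB.
Qed.

Lemma measurable_radial g n x : radial N k g ->
  (forall t, D t -> 0 < sqn (x - y t)) ->
  measurable_fun D (fun t => g n (sqn (x - y t))).
Proof.
move=> rg pos.
apply: (@measurable_comp _ _ _ T R R `]0, +oo[%classic (g n) D (fun t => sqn (x - y t))) => //.
- by move=> _ [t Dt <-]; rewrite /= in_itv /= andbT; exact: pos.
- apply: open_continuous_measurable_fun => // s.
  rewrite inE /= in_itv /= andbT => s0.
  exact: der_continuous (radial_derive rg n s s0).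
- exact: measurable_dist.
Qed.

Lemma kernel_integrable P g n x (d0 M : R) : radial N k g -> L1 P -> 0 < d0 ->
  (forall t, D t -> d0 <= sqn (x - y t) <= M) ->
  L1 (fun t => P t * g n (sqn (x - y t))).
Proof.
move=> rg iP d00 xM; have [C [K [_ _ H]]] := radial_bound M rg d00.
apply: (rintegrable_mul_bounded mD iP (C := C * K ^+ n * n`!%:R)).
  apply: measurable_radial => // t /xM/andP[+ _]; exact: lt_le_trans.
by move=> t Dt; apply: H; exact: xM.
Qed.

(** The order of the quantifiers matters: [rho] depends on [R0] alone and not on the point, the
    direction or the densities, so continuation can proceed by steps of fixed length. *)
Lemma potential_expansion (R0 : R) : 0 <= R0 -> R0 < r ->
  exists2 rho, 0 < rho & forall P Q x v, L1 P -> L1 Q ->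
    sqn x <= R0 ^+ 2 -> sqn v <= 1 ->
    exists C, forall M tau, `|tau| <= rho ->
      `|potential P Q (x + tau *: v)
        - \sum_(m < M) potential_coef P Q x v m * tau ^+ m|
      <= C * (`|tau| / rho) ^+ M.
Proof.
move=> R00 R0r.
(* The squared distances from [x] lie between [2 * d0] and [(r + R0) ^ 2]; the margin [d0] on both
   sides leaves room for moving along the line. *)
pose d0 := (r - R0) ^+ 2 / 2; pose M0 := (r + R0) ^+ 2 + d0.
have d00 : 0 < d0 by rewrite divr_gt0 // exprn_gt0 // subr_gt0.
have [C1 [K1 [C10 K10 H1]]] := radial_bound M0 rA d00.
have [C2 [K2 [C20 K20 H2]]] := radial_bound M0 rB d00.
pose C := C1 + C2; pose K := K1 + K2.
have C0 : 0 < C by rewrite addr_gt0.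
have K0 : 0 < K by rewrite addr_gt0.
have bnd (g : nat -> R -> R) (Cg Kg : R) : 0 < Cg -> Cg <= C -> 0 < Kg -> Kg <= K ->
    (forall n s, d0 <= s <= M0 -> `|g n s| <= Cg * Kg ^+ n * n`!%:R) ->
    forall n (s : R), d0 <= s <= M0 -> `|g n s| <= C * K ^+ n * n`!%:R.
  move=> Cg0 CgC Kg0 KgK H n s sM; apply: le_trans (H n s sM) _.
  apply: ler_wpM2r => //; apply: ler_pM => //; rewrite ?exprn_ge0 // ?(ltW Cg0) // ?(ltW Kg0) //.
  by apply: lerXn2r; rewrite ?nnegrE // ltW.
have {}H1 : forall n s, d0 <= s <= M0 -> `|A n s| <= C * K ^+ n * n`!%:R.
  by apply: (bnd A C1 K1) => //; rewrite lerDl ltW.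
have {}H2 : forall n s, d0 <= s <= M0 -> `|B n s| <= C * K ^+ n * n`!%:R.
  by apply: (bnd B C2 K2) => //; rewrite lerDr ltW.
(* [4 * r] bounds the linear coefficient [2 * dotp v (x - y t)] and 1 bounds the quadratic one,
   [sqn v]; for [rho <= 1] the increment of the squared distance is at most [E * rho]. *)
pose E := 4 * r + 1.
have E0 : 0 < E by rewrite /E; lra.
(* The three bounds serve, in order, to dominate [rho ^ 2] by [rho], to satisfy the smallness
   condition of [line_expansion], and to keep the increment below [d0]. *)
pose rho := Num.min 1 (Num.min (1 / (4 * K * E)) (d0 / E)).
have rho0 : 0 < rho.
  have KE : 0 < 4 * K * E by apply: mulr_gt0 => //; apply: mulr_gt0.
  by rewrite !lt_min ltr01 (divr_gt0 _ KE) // divr_gt0.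
have rho1 : rho <= 1 by rewrite ge_min lexx.
have rhoK : 4 * K * (E * rho) <= 1.
  rewrite mulrA mulrC -ler_pdivlMr ?mulr_gt0 // /rho !ge_min lexx.
  by rewrite orbT.
have rhod : E * rho <= d0.
  by rewrite mulrC -ler_pdivlMr // !ge_min lexx !orbT.
have Erho : 4 * r * rho + 1 * rho ^+ 2 <= E * rho.
  have : rho ^+ 2 <= rho by rewrite expr2 ler_piMl // ltW.
  by rewrite /E; move: (rho ^+ 2) => w; lra.
exists rho => // P Q x v iP iQ xR0 v1.
have sM0 t : D t -> d0 <= sqn (x - y t) <= M0.
  move=> Dt; have /andP[] := dist_bounds R00 R0r xR0 (yr Dt).
  by rewrite /M0 /d0 => h1 h2; apply/andP; split; have := sqr_ge0 (r - R0); lra.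
have alA t : D t -> `|2 * dotp v (x - y t)| <= 4 * r.
  move=> Dt; rewrite normrM ger0_norm // dotpBr.
  have e1 : `|dotp v x| <= 1 * R0 by apply: cauchy_schwarz; rewrite ?expr1n.
  have e2 : `|dotp v (y t)| <= 1 * r.
    by apply: cauchy_schwarz; rewrite ?expr1n // ?yr // ltW.
  have := ler_normB (dotp v x) (dotp v (y t)); lra.
have beB : `|sqn v| <= 1 by rewrite ger0_norm // sqn_ge0.
pose h t tau := 2 * dotp v (x - y t) * tau + sqn v * tau ^+ 2.
have hd t tau : D t -> `|tau| <= rho -> `|h t tau| <= d0.
  move=> Dt tr; apply: le_trans rhod; apply: le_trans Erho.
  apply: le_trans (ler_normD _ _) _.
  apply: lerD; rewrite normrM.
    by apply: ler_pM => //; exact: alA.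
  rewrite normrX; apply: ler_pM; rewrite ?exprn_ge0 //.
  by apply: lerXn2r; rewrite ?nnegrE // ltW.
have sM t tau : D t -> `|tau| <= rho -> d0 <= sqn (x + tau *: v - y t) <= M0.
  move=> Dt tr; rewrite sqn_line -/(h t tau).
  have := hd t tau Dt tr; rewrite ler_norml => /andP[].
  have /andP[] := dist_bounds R00 R0r xR0 (yr Dt).
  by rewrite /M0 /d0 => ? ? ? ?; apply/andP; split; lra.
pose H t := (`|P t| + `|Q t|) * C.
have H0 t : 0 <= H t by rewrite mulr_ge0 ?addr_ge0 // ltW.
have iH : L1 H.
  apply: (rintegrable_eq mD (f := fun t => C * (`|P t| + `|Q t|))).
    by move=> t _; rewrite mulrC.
  by apply: rintegrableZ => //; apply: rintegrableD => //; exact: rintegrable_abs.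
have fneq n : n`!%:R != 0 :> R by rewrite pnatr_eq0 -lt0n fact_gt0.
(* The bound holds for each surface point with a constant proportional to the integrable [H t], so
   integrating it yields the claim. *)
have point t tau M : D t -> `|tau| <= rho ->
    `|P t * A 0%N (sqn (x + tau *: v - y t)) + Q t * B 0%N (sqn (x + tau *: v - y t))
      - \sum_(m < M) line_coef (taylor_density P Q x t) (2 * dotp v (x - y t)) (sqn v) m * tau ^+ m|
    <= 3 * H t * (`|tau| / rho) ^+ M.
  move=> Dt tr.
  apply: (line_expansion (A := 4 * r) (B := 1) (K := K)) => //.
  - exact: ltW.
  - exact: alA.
  - apply: le_trans (ler_wpM2l _ Erho) _; first by rewrite mulr_ge0 // ltW.
    by move: rhoK; lra.
  - move=> n; rewrite /taylor_density normrM normfV (ger0_norm (_ : 0 <= n`!%:R)) //.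
    rewrite ler_pdivrMr ?ltr0n ?fact_gt0 // (le_trans (ler_normD _ _)) // !normrM.
    apply: (@le_trans _ _ (`|P t| * (C * K ^+ n * n`!%:R) + `|Q t| * (C * K ^+ n * n`!%:R))).
      by apply: lerD; apply: ler_wpM2l => //; [apply: H1|apply: H2]; exact: sM0.
    by rewrite /H le_eqVlt; apply/orP; left; apply/eqP; ring.
  - move=> m; rewrite -/(h t tau).
    have sE : sqn (x + tau *: v - y t) - sqn (x - y t) = h t tau.
      by rewrite sqn_line addrC addKr.
    have T1 := radial_taylor rA d00 (ltW C0) (ltW K0) H1 m (sM0 t Dt) (sM t tau Dt tr).
    have T2 := radial_taylor rB d00 (ltW C0) (ltW K0) H2 m (sM0 t Dt) (sM t tau Dt tr).
    rewrite sE in T1 T2.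
    set SA := \sum_(n < m) _ in T1; set SB := \sum_(n < m) _ in T2.
    have -> : \sum_(n < m) taylor_density P Q x t n * h t tau ^+ n = P t * SA + Q t * SB.
      rewrite /SA /SB !mulr_sumr -big_split /=; apply: eq_bigr => n _.
      by rewrite /taylor_density; field.
    set a := A 0%N _ in T1 *; set b := B 0%N _ in T2 *.
    have -> : P t * a + Q t * b - (P t * SA + Q t * SB) = P t * (a - SA) + Q t * (b - SB) by ring.
    have -> : H t * (2 * K * `|h t tau|) ^+ m = `|P t| * (C * (2 * K * `|h t tau|) ^+ m)
      + `|Q t| * (C * (2 * K * `|h t tau|) ^+ m) by rewrite /H; ring.
    apply: le_trans (ler_normD _ _) _; rewrite (normrM (P t)) (normrM (Q t)).
    by apply: lerD; apply: ler_wpM2l.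
have iA n : L1 (fun t => taylor_density P Q x t n).
  apply: (rintegrable_eq mD (f := fun t => n`!%:R^-1 *
    (P t * A n (sqn (x - y t)) + Q t * B n (sqn (x - y t))))).
    by move=> t _; rewrite /taylor_density mulrC.
  apply: rintegrableZ => //; apply: rintegrableD => //.
    exact: (kernel_integrable n rA iP d00 sM0).
  exact: (kernel_integrable n rB iQ d00 sM0).
have mal : measurable_fun D (fun t => 2 * dotp v (x - y t)).
  apply: measurable_funM => //.
  apply: (eq_measurable_fun (fun t => dotp v x - dotp v (y t))).
    by move=> t _; rewrite dotpBr.
  by apply: measurable_funB => //; exact: measurable_dotp.
have ic m : L1 (fun t => line_coef (taylor_density P Q x t) (2 * dotp v (x - y t)) (sqn v) m).
  rewrite /line_coef.
  apply: (rintegrable_sum mD (F := fun n t => taylor_density P Q x t n *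
     binom_term (2 * dotp v (x - y t)) (sqn v) n (m - n))) => n _.
  apply: (rintegrable_mul_bounded mD (iA n) (C := binom_term (4 * r) 1 n (m - n))).
    rewrite /binom_term; apply: measurable_funM => //; apply: measurable_funM => //.
    exact: measurable_funX.
  by move=> t Dt; apply: binom_term_norm => //; exact: alA.
exists (3 * \int[mu]_(t in D) H t) => M tau tr.
have isum : L1 (fun t => \sum_(m < M) line_coef (taylor_density P Q x t)
    (2 * dotp v (x - y t)) (sqn v) m * tau ^+ m).
  apply: (rintegrable_sum mD (F := fun m t => line_coef (taylor_density P Q x t)
    (2 * dotp v (x - y t)) (sqn v) m * tau ^+ m)) => m _.
  apply: (rintegrable_eq mD (f := fun t => tau ^+ m * line_coef (taylor_density P Q x t)
    (2 * dotp v (x - y t)) (sqn v) m)); first by move=> t _; rewrite mulrC.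
  exact: rintegrableZ.
have iF : L1 (fun t => P t * A 0%N (sqn (x + tau *: v - y t)) + Q t * B 0%N (sqn (x + tau *: v - y t))).
  have sM' t : D t -> d0 <= sqn (x + tau *: v - y t) <= M0 by move=> Dt; exact: sM.
  apply: rintegrableD => //.
    exact: (kernel_integrable 0 rA iP d00 sM').
  exact: (kernel_integrable 0 rB iQ d00 sM').
have -> : \sum_(m < M) potential_coef P Q x v m * tau ^+ m =
  \int[mu]_(t in D) \sum_(m < M) line_coef (taylor_density P Q x t)
    (2 * dotp v (x - y t)) (sqn v) m * tau ^+ m.
  rewrite (Rintegral_sum mD (F := fun m t => line_coef (taylor_density P Q x t)
    (2 * dotp v (x - y t)) (sqn v) m * tau ^+ m)).
    apply: eq_bigr => m _; rewrite /potential_coef mulrC -(RintegralZl _ mD (ic m)).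
    by apply: Rintegral_eq => // t _; rewrite mulrC.
  move=> m _; apply: (rintegrable_eq mD (f := fun t => tau ^+ m * line_coef (taylor_density P Q x t)
    (2 * dotp v (x - y t)) (sqn v) m)); first by move=> t _; rewrite mulrC.
  exact: rintegrableZ.
rewrite /potential -(RintegralB mD iF isum).
apply: le_trans (le_normr_Rintegral _ _) _ => //; first exact: rintegrableB.
have -> : 3 * \int[mu]_(t in D) H t * (`|tau| / rho) ^+ M =
  \int[mu]_(t in D) (3 * (`|tau| / rho) ^+ M * H t) by rewrite (RintegralZl _ mD iH); ring.
apply: le_Rintegral => //.
- by apply: rintegrable_abs => //; exact: rintegrableB.
- exact: rintegrableZ.
- move=> t Dt; apply: le_trans (point t tau M Dt tr) _.
  by rewrite le_eqVlt; apply/orP; left; apply/eqP; ring.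
Qed.

End Potential.

(** * Unique continuation to the origin and extraction of moments *)

Section Continuation.
Context d (T : measurableType d) {R : realType} (mu : {measure set T -> \bar R}).
Context (D : set T) (mD : measurable D) (N : nat) (y : T -> 'rV[R]_N) (r k : R).
Context (my : forall i, measurable_fun D (fun t => y t ord0 i)).
Context (r0 : 0 < r) (yr : forall t, D t -> sqn (y t) = r ^+ 2).
Context (A B : nat -> R -> R) (rA : radial N k A) (rB : radial N k B).
Implicit Types (P Q : T -> R) (x v : 'rV[R]_N) (tau : R).

Local Notation L1 := (rintegrable mu D).
Local Notation phi := (potential mu D y A B).
Local Notation coef := (potential_coef mu D y A B).

(** Vanishing along each line through [x], with [eps] allowed to depend on the direction: exactly
    what the one-variable identity principle consumes. *)
Definition vanishes_around P Q x : Prop := forall v, sqn v <= 1 ->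
  exists2 eps, 0 < eps & forall tau, `|tau| < eps -> phi P Q (x + tau *: v) = 0.

Lemma continuation_step (R0 : R) : 0 <= R0 -> R0 < r ->
  exists2 rho, 0 < rho & forall P Q x, L1 P -> L1 Q ->
    sqn x <= R0 ^+ 2 -> vanishes_around P Q x ->
    (forall v m, sqn v <= 1 -> coef P Q x v m = 0) /\
    (forall x', sqn (x' - x) < rho ^+ 2 -> vanishes_around P Q x').
Proof.
move=> R00 R0r; have [rho rho0 exp] := potential_expansion mu mD my r0 yr rA rB R00 R0r.
exists rho => // P Q x iP iQ xR0 van.
have both v : sqn v <= 1 -> (forall m, coef P Q x v m = 0) /\
    (forall tau, `|tau| < rho -> phi P Q (x + tau *: v) = 0).
  move=> v1; have [C H] := exp P Q x v iP iQ xR0 v1.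
  have [eps eps0 He] := van v v1.
  exact: (power_identity rho0 eps0 H He).
split=> [v m v1|]; first by have [+ _] := both v v1; exact.
have inball z : sqn (z - x) < rho ^+ 2 -> phi P Q z = 0.
  move=> zr; pose a := Num.sqrt (sqn (z - x)).
  have a0 : 0 <= a by exact: sqrtr_ge0.
  have aE : sqn (z - x) = a ^+ 2 by rewrite sqr_sqrtr ?sqn_ge0.
  have arho : a < rho by rewrite -(ltr_pXn2r (n := 2)) ?nnegrE ?(ltW rho0) // -aE.
  (* Strictly between [|z - x|] and [rho], so that [z = x + s *: v] with [v] in the unit ball; the
     case [z = x] needs no separate treatment. *)
  pose s := (a + rho) / 2.
  have s0 : 0 < s by rewrite /s; lra.
  have srho : s < rho by rewrite /s; lra.
  have sa : a <= s by rewrite /s; lra.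
  have s1 : s != 0 by rewrite gt_eqF.
  have v1 : sqn (s^-1 *: (z - x)) <= 1.
    rewrite sqnZ aE -exprMn -(expr1n _ 2) lerXn2r ?nnegrE //.
      by rewrite mulr_ge0 // invr_ge0 ltW.
    by rewrite mulrC ler_pdivrMr // mul1r.
  have [_ /(_ s)] := both _ v1; rewrite scalerA divff // scale1r addrC subrK.
  by apply; rewrite gtr0_norm.
(* The distance from [x'] to the boundary of the ball of radius [rho] around [x]. *)
move=> x' x'r v v1; exists (rho - Num.sqrt (sqn (x' - x))).
  rewrite subr_gt0 -(ltr_pXn2r (n := 2)) ?nnegrE ?sqrtr_ge0 ?(ltW rho0) //.
  by rewrite sqr_sqrtr ?sqn_ge0.
move=> tau taue; apply: inball.
by rewrite addrAC; apply: sqn_add_lt.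
Qed.

(** The segment from [x] to the origin is cut into [M] pieces shorter than [rho]. All the division
    points stay in the ball of radius [R0 = |x|], for which this [rho] is valid. *)
Lemma continuation_origin P Q x : L1 P -> L1 Q -> sqn x < r ^+ 2 ->
  vanishes_around P Q x -> forall v m, sqn v <= 1 -> coef P Q 0 v m = 0.
Proof.
move=> iP iQ xr van; pose R0 := Num.sqrt (sqn x).
have R00 : 0 <= R0 by exact: sqrtr_ge0.
have R0E : sqn x = R0 ^+ 2 by rewrite sqr_sqrtr ?sqn_ge0.
have R0r : R0 < r by rewrite -(ltr_pXn2r (n := 2)) ?nnegrE ?(ltW r0) // -R0E.
have [rho rho0 step] := continuation_step R00 R0r.
pose M := (Num.bound (R0 / rho)).+1.
have M0 : 0 < M%:R :> R by rewrite ltr0n.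
have M1 : M%:R != 0 :> R by rewrite gt_eqF.
have Mrho : R0 / M%:R < rho.
  rewrite ltr_pdivrMr // mulrC -ltr_pdivrMr //.
  have : R0 / rho < (Num.bound (R0 / rho))%:R.
    by apply: le_lt_trans (archi_boundP _); rewrite ?lexx // divr_ge0 // ltW.
  by move=> /lt_le_trans; apply; rewrite ler_nat leqnSn.
pose z j := ((M - j)%:R / M%:R) *: x.
have zR0 j : sqn (z j) <= R0 ^+ 2.
  rewrite sqnZ R0E ler_piMl ?sqr_ge0 // exprn_ile1 ?divr_ge0 //.
  by rewrite ler_pdivrMr // mul1r ler_nat leq_subr.
have vanz j : (j <= M)%N -> vanishes_around P Q (z j).
  elim: j => [_|j IH jM].
    by rewrite /z subn0 divff // scale1r.
  have [_] := step P Q (z j) iP iQ (zR0 j) (IH (ltnW jM)); apply.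
  have -> : z j.+1 - z j = (- M%:R^-1) *: x.
    rewrite /z -scalerBl -mulrBl; congr (_ *: _).
    rewrite subnS -[in X in _ - X](prednK (_ : 0 < M - j)%N) ?subn_gt0 //.
    by rewrite -natr1 opprD addNKr mulN1r.
  rewrite sqnZ sqrrN R0E -exprMn ltrXn2r ?nnegrE ?(ltW rho0) //.
    by rewrite mulr_ge0 // invr_ge0.
  by rewrite mulrC.
have z0 : z M = 0 by rewrite /z subnn mul0r scale0r.
have := vanz M (leqnn M); rewrite z0 => van0 v m v1.
have [|+ _] := step P Q 0 iP iQ _ van0; last by move=> /(_ v m v1).
by rewrite -z0; exact: zR0.
Qed.

(** At the origin the coefficient of order [m] is a combination of moments of order [2 n - m] with
    [n <= m], so the moments of order [m] enter only through [n = m] and the system is triangular.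
    The density pairs [(U, -V)] and [(V, U)] give two equations at each order, with determinant
    [A m ^ 2 + B m ^ 2]. *)
Lemma moments_vanish (U V : T -> R) x : L1 U -> L1 V -> k != 0 ->
  A 0%N (r ^+ 2) * B 1%N (r ^+ 2) - A 1%N (r ^+ 2) * B 0%N (r ^+ 2) != 0 ->
  sqn x < r ^+ 2 ->
  vanishes_around U (fun t => - V t) x -> vanishes_around V U x ->
  forall v m, \int[mu]_(t in D) (U t * dotp v (y t) ^+ m) = 0 /\
              \int[mu]_(t in D) (V t * dotp v (y t) ^+ m) = 0.
Proof.
move=> iU iV k0 W0 xr van1 van2.
have iNV : L1 (fun t => - V t) by exact: rintegrableN.
have c1 := continuation_origin iU iNV xr van1.
have c2 := continuation_origin iV iU xr van2.
have r20 : 0 < r ^+ 2 by rewrite exprn_gt0.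
pose al v t := 2 * dotp v (0 - y t).
have imom P v i : L1 P -> L1 (fun t => P t * al v t ^+ i).
  move=> iP; pose c := Num.sqrt (sqn v) * r.
  apply: (rintegrable_mul_bounded mD iP (C := (2 * c) ^+ i)).
    apply: measurable_funX; apply: measurable_funM => //.
    apply: (eq_measurable_fun (fun t => - dotp v (y t))).
      by move=> t _; rewrite sub0r dotpNr.
    by apply: measurableT_comp => //; exact: measurable_dotp.
  move=> t Dt; rewrite normrX; apply: lerXn2r; rewrite ?nnegrE //.
    by rewrite mulr_ge0 // mulr_ge0 ?sqrtr_ge0 // ltW.
  rewrite /al sub0r dotpNr mulrN normrN normrM ger0_norm // ler_wpM2l //.
  by apply: cauchy_schwarz; rewrite ?sqrtr_ge0 ?(ltW r0) ?yr // sqr_sqrtr ?sqn_ge0.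
pose I P v i := \int[mu]_(t in D) (P t * al v t ^+ i).
have coefE P Q v m : L1 P -> L1 Q -> coef P Q 0 v m =
    \sum_(n < m.+1) (A n (r ^+ 2) * I P v (n - (m - n))%N
       + B n (r ^+ 2) * I Q v (n - (m - n))%N) / n`!%:R * sqn v ^+ (m - n) * 'C(n, m - n)%:R.
  move=> iP iQ.
  pose F n t := (A n (r ^+ 2) / n`!%:R * sqn v ^+ (m - n) * 'C(n, m - n)%:R)
        * (P t * al v t ^+ (n - (m - n))) +
      (B n (r ^+ 2) / n`!%:R * sqn v ^+ (m - n) * 'C(n, m - n)%:R)
        * (Q t * al v t ^+ (n - (m - n))).
  have iF1 n c : L1 (fun t => c * (P t * al v t ^+ n)) by apply: rintegrableZ => //; exact: imom.
  have iF2 n c : L1 (fun t => c * (Q t * al v t ^+ n)) by apply: rintegrableZ => //; exact: imom.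
  rewrite /potential_coef (Rintegral_eq mu (g := fun t => \sum_(n < m.+1) F n t)); last first.
    move=> t Dt; rewrite /line_coef; apply: eq_bigr => n _.
    rewrite /taylor_density /binom_term sub0r sqnN yr // /F /al sub0r; ring.
  rewrite (Rintegral_sum mD (F := F)); last by move=> n _; exact: rintegrableD.
  apply: eq_bigr => n _; rewrite /F.
  rewrite (RintegralD mD (iF1 _ _) (iF2 _ _)).
  rewrite (RintegralZl _ mD (imom P v _ iP)) (RintegralZl _ mD (imom Q v _ iQ)).
  by rewrite /I; ring.
have small v m : sqn v <= 1 -> I U v m = 0 /\ I V v m = 0.
  move=> v1; elim/ltn_ind: m => m IH.
  have IV P i : I (fun t => - P t) v i = \int[mu]_(t in D) (-1 * (P t * al v t ^+ i)).
    by apply: Rintegral_eq => // t _; rewrite mulN1r mulNr.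
  have {}IV i : I (fun t => - V t) v i = - I V v i.
    by rewrite IV (RintegralZl _ mD (imom V v _ iV)) mulN1r.
  (* Truncated subtraction keeps the order [n - (m - n)] at most [n], hence below [m], so the
     induction hypothesis covers all these terms. *)
  have low n : (n < m)%N -> I U v (n - (m - n))%N = 0 /\ I V v (n - (m - n))%N = 0.
    by move=> nm; apply: IH; apply: leq_ltn_trans nm; exact: leq_subr.
  have := c1 v m v1; have := c2 v m v1; rewrite !coefE // !big_ord_recr /= !big1 ?add0r; last 2 first.
  - by move=> n _; rewrite ?IV; have [-> ->] := low n (ltn_ord n); rewrite ?oppr0 !mulr0 addr0 !mul0r.
  - by move=> n _; rewrite ?IV; have [-> ->] := low n (ltn_ord n); rewrite ?oppr0 !mulr0 addr0 !mul0r.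
  rewrite subnn subn0 expr0 bin0 !mulr1 IV.
  have f0 : m`!%:R != 0 :> R by rewrite pnatr_eq0 -lt0n fact_gt0.
  move=> /eqP; rewrite mulf_eq0 invr_eq0 (negbTE f0) orbF => /eqP E2.
  move=> /eqP; rewrite mulf_eq0 invr_eq0 (negbTE f0) orbF => /eqP E1.
  have AB := radial_nonzero rA rB k0 r20 W0 m.
  move: E1 E2 AB; move: (A m _) (B m _) (I U v m) (I V v m) => a b p q E1 E2 ab.
  have Ep : (a ^+ 2 + b ^+ 2) * p = 0.
    transitivity (a * (a * p + b * - q) + b * (a * q + b * p)); first ring.
    by rewrite E1 E2; ring.
  have Eq : (a ^+ 2 + b ^+ 2) * q = 0.
    transitivity (a * (a * q + b * p) - b * (a * p + b * - q)); first ring.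
    by rewrite E1 E2; ring.
  by split; apply/eqP; [move/eqP: Ep|move/eqP: Eq]; rewrite mulf_eq0 (negbTE ab).
(* A general direction is reduced to the unit ball by homogeneity; dividing by [1 + sqn v] instead
   of the norm admits [v = 0]. The factor [- s / 2] below undoes this scaling and the [-2] contained
   in [al]. *)
move=> v m; pose s := 1 + sqn v.
have s1 : 1 <= s by rewrite lerDl sqn_ge0.
have s0 : s != 0 by rewrite gt_eqF // (lt_le_trans ltr01).
have v1 : sqn (s^-1 *: v) <= 1.
  have s_0 : 0 < s by exact: lt_le_trans s1.
  rewrite sqnZ exprVn mulrC ler_pdivrMr ?exprn_gt0 // mul1r.
  apply: (@le_trans _ _ s); first by rewrite /s lerDr.
  by rewrite expr2 ler_peMl // ltW.
have E P : L1 P -> \int[mu]_(t in D) (P t * dotp v (y t) ^+ m) =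
    (- s / 2) ^+ m * I P (s^-1 *: v) m.
  move=> iP; rewrite /I -(RintegralZl _ mD (imom P _ _ iP)).
  apply: Rintegral_eq => // t _; rewrite /al sub0r dotpNr dotpZl mulrCA -exprMn.
  by congr (_ * _ ^+ _); field.
have [U0 V0] := small _ m v1.
by rewrite !E // U0 V0 mulr0.
Qed.

End Continuation.

(** * Determinacy by moments *)

Section StepApproximation.
Context {R : realType}.
Implicit Types (a x y : R).

Lemma bernoulli_le y m : 0 <= y <= 1 -> 1 - m%:R * y <= (1 - y) ^+ m.
Proof.
move=> /andP[y0 y1]; elim: m => [|m IH]; first by rewrite mul0r subr0 expr0.
have : (1 - y) * (1 - m%:R * y) <= (1 - y) ^+ m.+1.
  by rewrite exprS ler_wpM2l // subr_ge0.
apply: le_trans; rewrite -natr1.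
have : 0 <= m%:R * y ^+ 2 by rewrite mulr_ge0 // sqr_ge0.
by rewrite expr2; lra.
Qed.

Lemma bernoulli_ge y m : 0 <= y <= 1 -> (1 - y) ^+ m * (1 + m%:R * y) <= 1.
Proof.
move=> /andP[y0 y1]; elim: m => [|m IH]; first by rewrite mul0r addr0 expr0 mul1r.
apply: le_trans IH; rewrite exprSr -mulrA; apply: ler_wpM2l.
  by rewrite exprn_ge0 // subr_ge0.
have : 0 <= m%:R * y ^+ 2 by rewrite mulr_ge0 // sqr_ge0.
have : 0 <= y ^+ 2 by rewrite sqr_ge0.
by rewrite -natr1 expr2; lra.
Qed.

(** Sends [a] to 1/2, the threshold at which [(1 - t ^ n) ^ (2 ^ n)] switches from 1 to 0; with
    slope 1/4 the values stay in the unit interval when [a] and [x] lie between -1 and 1. *)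
Definition tilt a x : R := 2^-1 + (x - a) / 4.

(* The Brosowski-Deutsch polynomials, which converge boundedly to a step function. *)
Definition step_poly a (n : nat) : {poly R} :=
  (1 - ((2^-1 - a / 4)%:P + 4^-1 *: 'X) ^+ n) ^+ (2 ^ n).

Lemma step_polyE a n x : (step_poly a n).[x] = (1 - tilt a x ^+ n) ^+ (2 ^ n).
Proof.
have -> : tilt a x = 2^-1 - a / 4 + 4^-1 * x by rewrite /tilt; field.
by rewrite /step_poly !hornerE.
Qed.

Lemma tilt_bounds a x : `|a| <= 1 -> `|x| <= 1 -> 0 <= tilt a x <= 1.
Proof.
rewrite !ler_norml /tilt => /andP[? ?] /andP[? ?]; apply/andP; split; lra.
Qed.

Lemma step_poly_bounds a n x : `|a| <= 1 -> `|x| <= 1 -> 0 <= (step_poly a n).[x] <= 1.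
Proof.
move=> a1 x1; have /andP[t0 t1] := tilt_bounds a1 x1.
rewrite step_polyE; apply/andP; split.
  by rewrite exprn_ge0 // subr_ge0 exprn_ile1.
by rewrite exprn_ile1 // ?subr_ge0 ?exprn_ile1 // gerBl exprn_ge0.
Qed.

(** With [t = tilt a x], the Bernoulli inequalities bound the value below by [1 - (2 t) ^ n] and
    above by [(2 t) ^ - n]. At [x = a] the limit is [1 / e], neither value of the step, which is why
    the level set [c = a] must be negligible in [Rintegral_step_moments]. *)
Lemma step_poly_cvg a x : `|a| <= 1 -> `|x| <= 1 -> x != a ->
  (step_poly a n).[x] @[n --> \oo] --> ((x < a)%R%:R : R).
Proof.
move=> a1 x1; have /andP[t0 t1] := tilt_bounds a1 x1.
have tn n : 0 <= tilt a x ^+ n <= 1 by rewrite exprn_ge0 // exprn_ile1.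
rewrite neq_lt => /orP[xa|ax].
  rewrite xa mulr1n; apply: (@squeeze_cvgr _ _ _ _ (fun n => 1 - (2 * tilt a x) ^+ n) (fun=> 1)).
  - apply: nearW => n; have /andP[_ ->] := step_poly_bounds n a1 x1.
    rewrite step_polyE andbT; apply: le_trans (bernoulli_le _ (tn n)).
    by rewrite exprMn natrX.
  - rewrite -[X in _ --> X]subr0; apply: cvgB; first exact: cvg_cst.
    apply: cvg_expr; rewrite ger0_norm ?mulr_ge0 //.
    by rewrite /tilt; lra.
  - exact: cvg_cst.
rewrite ltNge (ltW ax) mulr0n.
have t2 : 1 < 2 * tilt a x by rewrite /tilt; lra.
have t20 : 0 < 2 * tilt a x by lra.
apply: (@squeeze_cvgr _ _ _ _ (fun=> 0) (fun n => (2 * tilt a x)^-1 ^+ n)).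
- apply: nearW => n; have /andP[-> _] := step_poly_bounds n a1 x1.
  rewrite step_polyE /= exprVn -div1r ler_pdivlMr ?exprn_gt0 //.
  apply: le_trans (bernoulli_ge (2 ^ n) (tn n)); apply: ler_wpM2l.
    by rewrite exprn_ge0 // subr_ge0; case/andP: (tn n).
  by rewrite exprMn natrX lerDr.
- exact: cvg_cst.
- apply: cvg_expr; rewrite ger0_norm ?invr_ge0 ?(ltW t20) //.
  by rewrite invf_lt1.
Qed.

End StepApproximation.

Section Moments.
Context d (T : measurableType d) {R : realType} (mu : {measure set T -> \bar R}).
Context (D : set T) (mD : measurable D).
Implicit Types (f c : T -> R).

Lemma measurable_step c (a : R) : measurable_fun D c ->
  measurable_fun D (fun t => (c t < a)%R%:R : R).
Proof.
move=> mc; apply: (@measurableT_comp _ _ _ _ _ _ (fun b : bool => b%:R : R)).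
  by [].
exact: measurable_fun_ltr.
Qed.

Lemma rintegrable_step f c (a : R) : rintegrable mu D f -> measurable_fun D c ->
  rintegrable mu D (fun t => f t * (c t < a)%R%:R).
Proof.
move=> iF mc; apply: (rintegrable_mul_bounded mD iF (C := 1)); first exact: measurable_step.
by move=> t _; rewrite normr_nat; case: (_ < _).
Qed.

Lemma Rintegral_step_moments f c (a : R) : rintegrable mu D f ->
  measurable_fun D c -> (forall t, D t -> `|c t| <= 1) -> `|a| <= 1 ->
  mu.-negligible (D `&` [set t | c t = a]) ->
  (forall n, \int[mu]_(t in D) (f t * c t ^+ n) = 0) ->
  \int[mu]_(t in D) (f t * (c t < a)%R%:R) = 0.
Proof.
move=> iF mc c1 a1 neg mom.
have ipow n : rintegrable mu D (fun t => f t * c t ^+ n).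
  apply: (rintegrable_mul_bounded mD iF (C := 1)); first exact: measurable_funX.
  by move=> t Dt; rewrite normrX exprn_ile1 // c1.
have ipoly (p : {poly R}) : rintegrable mu D (fun t => f t * p.[c t]) /\
    \int[mu]_(t in D) (f t * p.[c t]) = 0.
  have E t : D t -> \sum_(i < size p) p`_i * (f t * c t ^+ i) = f t * p.[c t].
    by move=> _; rewrite horner_coef mulr_sumr; apply: eq_bigr => i _; rewrite mulrCA.
  have iZ i : rintegrable mu D (fun t => p`_i * (f t * c t ^+ i)) by exact: rintegrableZ.
  have iS : rintegrable mu D (fun t => \sum_(i < size p) p`_i * (f t * c t ^+ i)).
    exact: (rintegrable_sum mD (F := fun i t => p`_i * (f t * c t ^+ i))).
  split; first exact: rintegrable_eq E iS.
  rewrite -(Rintegral_eq mu E) (Rintegral_sum mD (F := fun i t => p`_i * (f t * c t ^+ i))) //.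
  by apply: big1 => i _; rewrite (RintegralZl _ mD (ipow i)) mom mulr0.
have istep := rintegrable_step a iF mc.
have m1 n : measurable_fun D (fun t => (f t * (step_poly a n).[c t])%:E).
  by apply/measurable_EFinP; exact: (rintegrable_measurable (ipoly (step_poly a n)).1).
have m2 : measurable_fun D (fun t => (f t * (c t < a)%R%:R)%:E).
  by apply/measurable_EFinP; exact: (rintegrable_measurable istep).
have ia : mu.-integrable D (fun t => `|f t|%:E) by exact: rintegrable_abs.
have lim : \forall t \ae mu, D t ->
    (f t * (step_poly a n).[c t])%:E @[n --> \oo] --> (f t * (c t < a)%R%:R)%:E.
  apply: negligibleS neg => t /= /not_implyP[Dt H]; split=> //.
  apply: contra_notP H => /eqP ca; apply: cvg_EFin; first exact: nearW.
  by apply: cvgMl_tmp; apply: step_poly_cvg => //; exact: c1.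
have dom : \forall t \ae mu, forall n, D t ->
    (`|(f t * (step_poly a n).[c t])%:E| <= `|f t|%:E)%E.
  apply: aeW => t n Dt; rewrite /= lee_fin normrM ler_piMr //.
  have /andP[p0 p1] := step_poly_bounds n a1 (c1 t Dt).
  by rewrite ger0_norm.
have [_ _ H] := dominated_convergence mD m1 m2 lim ia dom.
have H0 : (fun n => \int[mu]_(t in D) (f t * (step_poly a n).[c t])%:E)%E = cst 0%E.
  apply/funext => n; have [iP P0] := ipoly (step_poly a n).
  rewrite -(fineK (integrable_fin_num mD iP)) -[fine _]/(Rintegral mu D _).
  by congr (_%:E).
by rewrite /Rintegral; move: H; rewrite /= H0 => /cvg_lim <- //; rewrite lim_cst.
Qed.

End Moments.

Lemma rintegrable_mkcond d (T : measurableType d) (R : realType)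
    (mu : {measure set T -> \bar R}) (D : set T) (f : T -> R) : measurable D ->
  rintegrable mu D f <-> rintegrable mu setT (f \_ D).
Proof.
by move=> mD; rewrite /rintegrable -restrict_EFin; exact: integrable_mkcond.
Qed.

(** * Uniqueness from moments on an interval and on the circle *)

Section IntervalUniqueness.
Context {R : realType}.
Notation leb := (@lebesgue_measure R).
Implicit Types (f c h : R -> R) (u w b : R).

Lemma ae_neq (a : R) : {ae leb, forall t, t <> a}.
Proof.
have : leb.-negligible [set a] by apply/negligibleP => //; exact: lebesgue_measure_set1.
by apply: negligibleS => t /= /contrapT.
Qed.

(** The extension of [f] by zero has a zero primitive on the whole line, and is almost everywhere
    the derivative of that primitive. *)
Lemma vanishing_primitive f u w : rintegrable leb `[u, w] f ->
  (forall b, b \in `[u, w] -> \int[leb]_(t in `[u, w]) (f t * (t < b)%R%:R) = 0) ->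
  \int[leb]_(t in `[u, w]) f t = 0 ->
  {ae leb, forall t, t \in `[u, w] -> f t = 0}.
Proof.
move=> iF fb f0; pose g := f \_ `[u, w].
have ig : leb.-integrable setT (EFin \o g).
  exact: (iffLR (rintegrable_mkcond leb f (measurable_itv _)) iF).
have igy (y : R) : leb.-integrable `]-oo, y] (EFin \o g) by exact: integrableS ig.
have lg : locally_integrable [set: R] g by exact: integrable_locally_restrict.
have F0 (x : R) : \int[leb]_(t in `]-oo, x]) g t = 0.
  rewrite -Rintegral_itv_bndo_bndc; last first.
    by apply: integrableS ig.
  have -> : \int[leb]_(t in `]-oo, x[) g t = \int[leb]_(t in `[u, w]) (f t * (t < x)%R%:R).
    rewrite [LHS]Rintegral_mkcond [RHS]Rintegral_mkcond; congr (Rintegral _ _ _).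
    apply/funext => t; rewrite /g !patchE !mem_setE !in_itv /=.
    by case: (t < x); case: (u <= t <= w); rewrite ?mulr1 ?mulr0.
  have [xu|ux] := leP x u.
    apply: Rintegral_eq0 => // t; rewrite /= in_itv /= => /andP[ut _].
    by rewrite ltNge (le_trans xu ut) mulr0.
  have [xw|wx] := leP x w; first by apply: fb; rewrite in_itv /= (ltW ux).
  rewrite -[RHS]f0; apply: Rintegral_eq => t; rewrite /= in_itv /= => /andP[_ tw].
  by rewrite (le_lt_trans tw wx) mulr1.
have := FTC1Ny igy lg; rewrite /=.
rewrite (_ : (fun x : R => \int[leb]_(t in `]-oo, x]) g t) = cst 0); last first.
  by apply/funext => x; exact: F0.
apply: filterS; first exact: (ae_filter_ringOfSetsType leb).
move=> x [_]; rewrite derive1_cst /g patchE mem_setE => H xuw.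
by rewrite xuw in H.
Qed.

(** For strictly increasing [c] the sublevel set of [c b] is the part of the interval before [b],
    and the level sets of [c] are single points, hence negligible. *)
Lemma monotone_moments f c u w : rintegrable leb `[u, w] f ->
  measurable_fun `[u, w] c -> (forall t, t \in `[u, w] -> `|c t| <= 1) ->
  (forall t b, t \in `[u, w] -> b \in `[u, w] -> (c t < c b) = (t < b)) ->
  (forall n, \int[leb]_(t in `[u, w]) (f t * c t ^+ n) = 0) ->
  {ae leb, forall t, t \in `[u, w] -> f t = 0}.
Proof.
move=> iF mc c1 cmono mom; apply: vanishing_primitive => // [b bu|].
  have <- : \int[leb]_(t in `[u, w]) (f t * (c t < c b)%R%:R) = 0.
    apply: Rintegral_step_moments => //; last first.
    - have : leb.-negligible [set b] by apply/negligibleP => //; exact: lebesgue_measure_set1.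
      apply: negligibleS => t [/= tu /= ctb].
      by apply/eqP; rewrite eq_le !leNgt -(cmono _ _ tu bu) -(cmono _ _ bu tu) ctb ltxx.
    - exact: c1.
  by apply: Rintegral_eq => t tu; rewrite cmono.
by rewrite -[RHS](mom 0%N); apply: Rintegral_eq => t _; rewrite expr0 mulr1.
Qed.

Lemma cos_moments_upper f : rintegrable leb `[0, pi] f ->
  (forall n, \int[leb]_(t in `[0, pi]) (f t * cos t ^+ n) = 0) ->
  {ae leb, forall t, t \in `[0, pi] -> f t = 0}.
Proof.
move=> iF mom; have mcos : measurable_fun `[0, pi] (@cos R).
  by apply: measurable_funTS; apply: continuous_measurable_fun; exact: continuous_cos.
apply: (monotone_moments (c := fun t => - cos t)) => //.
- exact: measurableT_comp.
- by move=> t _; rewrite normrN cos_max.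
- by move=> t b tp bp; rewrite ltrN2 ltr_cos.
- move=> n.
  have ipow : rintegrable leb `[0, pi] (fun t => f t * cos t ^+ n).
    apply: (rintegrable_mul_bounded _ iF (C := 1)) => //; first exact: measurable_funX.
    by move=> t _; rewrite normrX exprn_ile1 // cos_max.
  transitivity ((-1) ^+ n * \int[leb]_(t in `[0, pi]) (f t * cos t ^+ n)); last by rewrite mom mulr0.
  rewrite -(RintegralZl _ _ ipow) //.
  by apply: Rintegral_eq => t _; rewrite (exprNn (cos t)) mulrCA.
Qed.

Lemma cos_moments_lower f : rintegrable leb `[pi, 2 * pi] f ->
  (forall n, \int[leb]_(t in `[pi, 2 * pi]) (f t * cos t ^+ n) = 0) ->
  {ae leb, forall t, t \in `[pi, 2 * pi] -> f t = 0}.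
Proof.
move=> iF mom; apply: (monotone_moments (c := cos)) => //.
- by apply: measurable_funTS; apply: continuous_measurable_fun; exact: continuous_cos.
- by move=> t _; exact: cos_max.
- move=> t b tp bp.
  have E (x : R) : cos x = - cos (x - pi) by rewrite -[in LHS](subrK pi x) cosDpi.
  have I (x : R) : x \in `[pi, 2 * pi] -> x - pi \in `[0, pi].
    by rewrite !in_itv /= => /andP[? ?]; apply/andP; split; lra.
  by rewrite (E t) (E b) ltrN2 ltr_cos ?I // ltrD2r.
Qed.

Lemma sin_lt0_lower (t : R) : pi < t < 2 * pi -> sin t < 0.
Proof.
move=> /andP[pt t2]; rewrite -[t](subrK pi) sinDpi oppr_lt0.
by apply: sin_gt0_pi; apply/andP; split; lra.
Qed.

(** Powers of [cos] determine a function only on a half circle, where [cos] is injective. The powers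
    of [sin] serve to cut the circle: through [Rintegral_step_moments] they produce the indicator
    [s] of [sin < 0], and the [cos] moments then vanish on each half. *)
Lemma circle_moments h : rintegrable leb `[0, 2 * pi[ h ->
  (forall a b : nat, \int[leb]_(t in `[0, 2 * pi[) (h t * (cos t ^+ a * sin t ^+ b)) = 0) ->
  {ae leb, forall t, t \in `[0, 2 * pi[ -> h t = 0}.
Proof.
move=> ih mom; have p0 := pi_gt0 R.
set D := [set` `[0, 2 * pi[] in ih mom *.
have mD : measurable (D : set (measurableTypeR R)) by exact: measurable_itv.
have mcos : measurable_fun (D : set (measurableTypeR R)) (@cos R).
  by apply: measurable_funTS; apply: continuous_measurable_fun; exact: continuous_cos.
have msin : measurable_fun (D : set (measurableTypeR R)) (@sin R).
  by apply: measurable_funTS; apply: continuous_measurable_fun; exact: continuous_sin.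
have icos a : rintegrable leb D (fun t => h t * cos t ^+ a).
  apply: (rintegrable_mul_bounded mD ih (C := 1)); first exact: measurable_funX.
  by move=> t _; rewrite normrX exprn_ile1 // cos_max.
pose s (t : R) : R := (sin t < 0)%R%:R.
have is_ a : rintegrable leb D (fun t => h t * cos t ^+ a * s t).
  exact: rintegrable_step.
have neg0 : leb.-negligible (D `&` [set t | sin t = 0]).
  have := @negligibleU _ _ _ leb [set 0] [set (pi : R)].
  have n1 (x : R) : leb.-negligible [set x] by apply/negligibleP => //; exact: lebesgue_measure_set1.
  move=> /(_ (n1 _) (n1 _)); apply: negligibleS => t [Dt st].
  move: Dt; rewrite /D /= in_itv /= => /andP[t0 t2]; move: st => /= st.
  have [tp|pt|->] := ltgtP t pi; [left|exfalso|by right].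
    apply/eqP; rewrite eq_le t0 andbT leNgt; apply/negP => t_0.
    by have := sin_gt0_pi (_ : 0 < t < pi); rewrite st ltxx t_0 tp => /(_ isT).
  by have := sin_lt0_lower (_ : pi < t < 2 * pi); rewrite st ltxx pt t2 => /(_ isT).
have lower a : \int[leb]_(t in D) (h t * cos t ^+ a * s t) = 0.
  apply: Rintegral_step_moments => //.
  - by move=> t _; rewrite ler_norml sin_geN1 sin_le1.
  - by rewrite normr0.
  - by move=> n; rewrite -[RHS](mom a n); apply: Rintegral_eq => t _; rewrite mulrA.
have upper a : \int[leb]_(t in D) (h t * (1 - s t) * cos t ^+ a) = 0.
  have -> : \int[leb]_(t in D) (h t * (1 - s t) * cos t ^+ a) =
      \int[leb]_(t in D) (h t * cos t ^+ a - h t * cos t ^+ a * s t).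
    by apply: Rintegral_eq => t _; ring.
  rewrite (RintegralB mD (icos a) (is_ a)) lower subr0 -[RHS](mom a 0%N).
  by apply: Rintegral_eq => t _; rewrite expr0 mulr1.
have sU (t : R) : 0 <= t <= pi -> s t = 0.
  by move=> tp; rewrite /s ltNge sin_ge0_pi.
have sL (t : R) : pi < t < 2 * pi -> s t = 1.
  by move=> tp; rewrite /s sin_lt0_lower.
(* The point [2 * pi] belongs to the closed lower half but not to [D]; since [s] vanishes there, the
   zero extensions in [pL] agree everywhere. *)
have s2 (t : R) : t = 2 * pi -> s t = 0.
  by move=> ->; rewrite /s mulr_natl sin2pi ltxx.
have pU (q : R -> R) : (fun t => h t * (1 - s t) * q t) \_ D = (fun t => h t * q t) \_ `[0, pi].
  apply/funext => t; rewrite !patchE !mem_setE !in_itv /=.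
  have [t0|t0] := leP 0 t => //=.
  have [tp|pt] := leP t pi.
    by rewrite (_ : t < 2 * pi) ?sU ?t0 ?subr0 ?mulr1 //; lra.
  case: ltP => // t2; by rewrite sL ?pt // subrr mulr0 mul0r.
have pL (q : R -> R) : (fun t => h t * q t * s t) \_ D = (fun t => h t * s t * q t) \_ `[pi, 2 * pi].
  apply/funext => t; rewrite !patchE !mem_setE !in_itv /=.
  have [t2|t2|t2] := ltgtP t (2 * pi).
  - rewrite !andbT; have [pt|tp] := leP pi t.
      by rewrite (_ : 0 <= t); [rewrite mulrAC|lra].
    by case: ifP => // t0; rewrite sU ?mulr0 // t0 ltW.
  - by rewrite !andbF.
  - by rewrite s2 // !(mulr0, mul0r) andbF; case: ifP.
have ihU : rintegrable leb `[0, pi] h.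
  have : rintegrable leb D (fun t => h t * (1 - s t) * 1).
    apply: (rintegrable_eq mD (f := fun t => h t * cos t ^+ 0 - h t * cos t ^+ 0 * s t)).
      by move=> t _; rewrite expr0; ring.
    by apply: rintegrableB.
  move=> /(iffLR (rintegrable_mkcond leb _ mD)); rewrite (pU (fun=> 1)).
  move=> /(iffRL (rintegrable_mkcond leb _ (measurable_itv _))).
  by apply: rintegrable_eq => // t _; rewrite mulr1.
have ihL : rintegrable leb `[pi, 2 * pi] (fun t => h t * s t).
  have : rintegrable leb D (fun t => h t * 1 * s t).
    by apply: rintegrable_eq (is_ 0%N) => // t _; rewrite expr0.
  move=> /(iffLR (rintegrable_mkcond leb _ mD)); rewrite (pL (fun=> 1)).
  move=> /(iffRL (rintegrable_mkcond leb _ (measurable_itv _))).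
  by apply: rintegrable_eq => // t _; rewrite mulr1.
have momU n : \int[leb]_(t in `[0, pi]) (h t * cos t ^+ n) = 0.
  by rewrite -[RHS](upper n) [LHS]Rintegral_mkcond [RHS]Rintegral_mkcond (pU (fun t => cos t ^+ n)).
have momL n : \int[leb]_(t in `[pi, 2 * pi]) (h t * s t * cos t ^+ n) = 0.
  by rewrite -[RHS](lower n) [LHS]Rintegral_mkcond [RHS]Rintegral_mkcond (pL (fun t => cos t ^+ n)).
apply: (@filterS3 _ _ (ae_filter_ringOfSetsType leb) _ _ _ _ _
  (cos_moments_upper ihU momU) (cos_moments_lower ihL momL) (ae_neq pi)).
move=> t H1 H2 tp; rewrite in_itv /= => /andP[t0 t2].
have [tlep|plet] := leP t pi; first by apply: H1; rewrite in_itv /= t0.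
rewrite -[LHS]mulr1 -(sL t) ?plet //; apply: H2.
by rewrite in_itv /= !ltW.
Qed.

End IntervalUniqueness.

Lemma poly_fun0 (R : realType) (p : {poly R}) : (forall z, p.[z] = 0) -> p = 0.
Proof.
move=> p0; apply/eqP; apply/negPn/negP => pn0.
have := max_poly_roots pn0 (rs := [seq i%:R | i <- iota 0 (size p)]).
rewrite size_map size_iota ltnn => H.
suff: false by []; apply: H.
  by apply/allP => z _; apply/rootP.
by rewrite map_inj_uniq ?iota_uniq // => i j /eqP; rewrite eqr_nat => /eqP.
Qed.

(** Polarisation: for fixed [n] the integral is a polynomial in [z] that vanishes identically, and
    its coefficients are binomial multiples of the mixed moments of total degree [n]. The claim is
    read off at [n = i + j]. *)
Lemma binomial_moments d (T : measurableType d) (R : realType)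
    (mu : {measure set T -> \bar R}) (D : set T) (f X Y : T -> R) (C : R) :
  measurable D -> rintegrable mu D f ->
  measurable_fun D X -> measurable_fun D Y ->
  (forall t, D t -> `|X t| <= C) -> (forall t, D t -> `|Y t| <= C) ->
  (forall n z, \int[mu]_(t in D) (f t * (X t + z * Y t) ^+ n) = 0) ->
  forall i j, \int[mu]_(t in D) (f t * (X t ^+ i * Y t ^+ j)) = 0.
Proof.
move=> mD iF mX mY XC YC mom i j.
pose F n m t := f t * (X t ^+ (n - m) * Y t ^+ m).
have iFF n m : rintegrable mu D (F n m).
  apply: (rintegrable_mul_bounded mD iF (C := `|C| ^+ (n - m) * `|C| ^+ m)).
    by apply: measurable_funM; exact: measurable_funX.
  move=> t Dt; rewrite normrM !normrX; apply: ler_pM; rewrite ?exprn_ge0 //.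
    by apply: lerXn2r; rewrite ?nnegrE // (le_trans (XC t Dt)) // ler_norm.
  by apply: lerXn2r; rewrite ?nnegrE // (le_trans (YC t Dt)) // ler_norm.
pose p n := \poly_(m < n.+1) ('C(n, m)%:R * \int[mu]_(t in D) F n m t).
have p0 n : p n = 0.
  apply: poly_fun0 => z; rewrite horner_poly -[RHS](mom n z).
  rewrite (Rintegral_eq mu (g := fun t => \sum_(m < n.+1) ('C(n, m)%:R * z ^+ m) * F n m t)); last first.
    move=> t _; rewrite exprDn mulr_sumr; apply: eq_bigr => m _.
    by rewrite /F exprMn -mulr_natr; ring.
  rewrite (Rintegral_sum mD (F := fun m t => ('C(n, m)%:R * z ^+ m) * F n m t)); last first.
    by move=> m _; exact: rintegrableZ.
  apply: eq_bigr => m _; rewrite (RintegralZl _ mD (iFF n m)); ring.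
have := congr1 (fun q : {poly R} => q`_j) (p0 (i + j)%N).
rewrite coef_poly coef0 ltnS leq_addl => /eqP.
rewrite mulf_eq0 pnatr_eq0 -leqn0 leqNgt bin_gt0 leq_addl /= => /eqP.
by rewrite /F addnK.
Qed.

(** * Uniqueness from moments on the sphere *)

Section SphereUniqueness.
Context {R : realType}.
Notation leb := (@lebesgue_measure R).
Notation leb2 := (leb \x leb)%E.

Lemma measurable_sphere_dom :
  measurable (@sphere_dom R : set (measurableTypeR R * measurableTypeR R)).
Proof. by apply: measurableX; exact: measurable_itv. Qed.

(* By Fubini, for almost every latitude [z.1] the section of [W] has vanishing
   trigonometric moments; the factor [sin z.1 ^+ (a + b)] is nonzero inside. *)
Lemma sphere_moments (W : R * R -> R) : rintegrable leb2 (@sphere_dom R) W ->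
  (forall a b j : nat, \int[leb2]_(z in @sphere_dom R)
     (W z * ((sin z.1 * cos z.2) ^+ a * (sin z.1 * sin z.2) ^+ b * cos z.1 ^+ j)) = 0) ->
  (\int[leb2]_(z in @sphere_dom R) `|W z|%:E = 0)%E.
Proof.
move=> iW mom; have mD := measurable_sphere_dom.
set D := @sphere_dom R in iW mom mD *.
pose V := W \_ D.
have iV : rintegrable leb2 setT V by exact: (iffLR (rintegrable_mkcond leb2 W mD) iW).
have V0 (p t : R) : p \notin `[0, pi] -> V (p, t) = 0.
  move=> pn; rewrite /V patchE ifF //; apply/negbTE; apply: contra pn.
  by rewrite inE => -[].
have mfst (f : R -> R) : continuous f ->
    measurable_fun [set: measurableTypeR R * measurableTypeR R] (fun z => f z.1).
  by move=> cf; apply: measurableT_comp => //; exact: continuous_measurable_fun.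
have msnd (f : R -> R) : continuous f ->
    measurable_fun [set: measurableTypeR R * measurableTypeR R] (fun z => f z.2).
  by move=> cf; apply: measurableT_comp => //; exact: continuous_measurable_fun.
have cc := @continuous_cos R; have cs := @continuous_sin R.
have sin1 (x : R) n : `|sin x ^+ n| <= 1.
  by rewrite normrX exprn_ile1 // ler_norml sin_geN1 sin_le1.
have cos1 (x : R) n : `|cos x ^+ n| <= 1 by rewrite normrX exprn_ile1 // cos_max.
have mul1 (x y : R) : `|x| <= 1 -> `|y| <= 1 -> `|x * y| <= 1.
  by move=> x1 y1; rewrite normrM mulr_ile1.
pose g (a b : nat) (z : measurableTypeR R * measurableTypeR R) : R := V z * (cos z.2 ^+ a * sin z.2 ^+ b).
have ig a b : rintegrable leb2 setT (g a b).
  apply: (rintegrable_mul_bounded measurableT iV (C := 1)).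
    by apply: measurable_funM; apply: measurable_funX; exact: msnd.
  by move=> z _; exact: mul1.
pose G a b (p : R) : R := \int[leb]_t g a b (p, t).
have iG a b : rintegrable leb setT (G a b).
  have iFub := integrable_fubini_F (ig a b).
  apply: le_integrable (iFub) => //.
    apply/measurable_EFinP; apply: measurableT_comp; first exact: fine_measurable.
    exact: (measurable_int _ iFub).
  (* Where the inner integral is infinite [fine] returns 0, so the domination by the Fubini function
     also holds there. *)
  move=> p _; 
  have -> : (EFin \o G a b) p = (fine (fubini_F leb (EFin \o g a b) p))%:E by [].
  by case: (fubini_F _ _ _) => [x| |] //=; rewrite normr0 // leey.
have G0 a b (p : R) : p \notin `[0, pi] -> G a b p = 0.
  by move=> pn; apply: Rintegral_eq0 => // t _; rewrite /g V0 // mul0r.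
(* Integrating first over the longitude turns the moments of [W] into [cos] moments, in the
   latitude, of [G a b] times the power of [sin] contributed by the two horizontal coordinates. *)
have key a b j : \int[leb]_(p in `[0, pi]) (G a b p * sin p ^+ (a + b) * cos p ^+ j) = 0.
  pose f (z : measurableTypeR R * measurableTypeR R) : R := g a b z * (sin z.1 ^+ (a + b) * cos z.1 ^+ j).
  have if_ : rintegrable leb2 setT f.
    apply: (rintegrable_mul_bounded measurableT (ig a b) (C := 1)).
      by apply: measurable_funM; apply: measurable_funX; exact: mfst.
    by move=> z _; exact: mul1.
  have f0 : (\int[leb2]_z (f z)%:E = 0)%E.
    rewrite -(fineK (integrable_fin_num measurableT if_)) -[fine _]/(Rintegral leb2 setT f).
    suff -> : Rintegral leb2 setT f = 0 by [].
    rewrite -[RHS](mom a b j) [RHS]Rintegral_mkcond.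
    congr (Rintegral _ _ _); apply/funext => z.
    rewrite /f /g /V !patchE; case: ifP => _; last by rewrite !mul0r.
    by rewrite !exprMn exprD; ring.
  have ae1 := ae_integrable1 (ig a b).
  have E : (\int[leb]_p (G a b p * (sin p ^+ (a + b) * cos p ^+ j))%:E = 0)%E.
    rewrite -[RHS]f0 -(integral12_prod_meas1 if_).
    apply: ae_eq_integral => //.
    - apply/measurable_EFinP; apply: measurable_funM.
        exact: (rintegrable_measurable (iG a b)).
      by apply: measurable_funM; apply: measurable_funX; exact: continuous_measurable_fun.
    - exact: (measurable_int _ (integrable_fubini_F if_)).
    - apply: filterS ae1 => p ip _.
      rewrite /fubini_F /f /G /=.
      have ip' : rintegrable leb setT (fun t => g a b (p, t)) by [].
      rewrite -(RintegralZr _ measurableT ip') /Rintegral fineK //.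
      apply: integrable_fin_num => //.
      by apply: rintegrable_eq (rintegrableZ measurableT (sin p ^+ (a + b) * cos p ^+ j) ip') => // t _; rewrite mulrC.
  rewrite Rintegral_mkcond; apply: (etrans _ (congr1 fine E)).
  rewrite /Rintegral; congr fine; congr (integral _ _ _); apply/funext => p.
  rewrite patchE mem_setE; case: ifPn => [_|pn]; first by rewrite mulrA.
  by rewrite G0 // mul0r.
have mI : measurable (`[0, pi] : set (measurableTypeR R)) by exact: measurable_itv.
have iGs a b : rintegrable leb `[0, pi] (fun p => G a b p * sin p ^+ (a + b)).
  have iG' : rintegrable leb `[0, pi] (G a b) by apply: integrableS (iG a b).
  apply: (rintegrable_mul_bounded mI iG' (C := 1)) => // .
  by apply: measurable_funTS; apply: measurable_funX; exact: continuous_measurable_fun.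
(* There are countably many pairs [(a, b)], so one null set of latitudes serves them all. *)
have ae1 : {ae leb, forall p, forall a b, p \in `[0, pi] -> G a b p * sin p ^+ (a + b) = 0}.
  apply: ae_foralln => a; apply: ae_foralln => b.
  exact: (cos_moments_upper (iGs a b) (key a b)).
have ae2 := ae_integrable1 iV.
have aeV : {ae leb, forall p, (\int[leb]_t `|V (p, t)|%:E = 0)%E}.
  (* The poles [p = 0] and [p = pi], where [sin p] cannot be cancelled, are discarded along with the
     latitudes whose section is not integrable. *)
  have F4 := @filterS3 _ _ (ae_filter_ringOfSetsType leb) _ _ _ _ _
    ae1 ae2 (@filterI _ _ (ae_filter_ringOfSetsType leb) _ _ (ae_neq 0) (ae_neq pi)).
  apply: F4 => p H1 H2 [p0 ppi].
  have [pI|pn] := boolP (p \in `[0, pi]); last first.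
    by apply: integral0_eq => t _; rewrite V0 // normr0.
  have sp : sin p != 0.
    rewrite gt_eqF // sin_gt0_pi //; move: pI; rewrite in_itv /= => /andP[h1 h2].
    by rewrite !lt_neqAle h1 h2 !andbT eq_sym; apply/andP; split; apply/eqP.
  have Vt (t : R) : V (p, t) = ((fun s => W (p, s)) \_ `[0, 2 * pi[) t.
    rewrite /V !patchE; congr (if _ then _ else _).
    by apply/idP/idP; rewrite !inE; [case|split].
  have ih : rintegrable leb `[0, 2 * pi[ (fun s => W (p, s)).
    apply: (iffRL (rintegrable_mkcond leb _ (measurable_itv _))).
    by apply: rintegrable_eq (H2 : rintegrable leb setT (fun t => V (p, t))) => // t _; rewrite Vt.
  have hm a b : \int[leb]_(t in `[0, 2 * pi[) (W (p, t) * (cos t ^+ a * sin t ^+ b)) = 0.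
    have : G a b p = 0.
      apply/eqP; have /eqP := H1 a b pI.
      by rewrite mulf_eq0 expf_eq0 (negbTE sp) andbF orbF.
    move=> G00; rewrite -[RHS]G00 Rintegral_mkcond /G; congr (Rintegral _ _ _); apply/funext => t.
    by rewrite /g Vt !patchE; case: ifP => //; rewrite mul0r.
  have aeh := circle_moments ih hm.
  apply/(ae_eq_integral_abs leb measurableT (f := fun t => (V (p, t))%:E)) => //.
    exact: (measurable_int _ H2).
  apply: (@filterS _ _ (ae_filter_ringOfSetsType leb) _ _ _ aeh) => t Ht _ /=; rewrite Vt patchE mem_setE.
  by case: ifP => // tI; rewrite Ht.
have absV : (\int[leb2]_(z in D) `|W z|%:E = \int[leb2]_z `|V z|%:E)%E.
  rewrite integral_mkcond; congr (integral _ _ _); apply/funext => z.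
  by rewrite /V !patchE; case: ifP => // _; rewrite normr0.
have mV : measurable_fun [set: measurableTypeR R * measurableTypeR R] (fun z => `|V z|%:E).
  by apply/measurable_EFinP; apply: measurableT_comp => //; exact: (rintegrable_measurable iV).
rewrite absV fubini_tonelli1 //.
rewrite -[RHS](@integral0 _ _ _ leb setT); apply: ae_eq_integral => //.
  by apply: measurable_fun_fubini_tonelli_F.
by apply: (@filterS _ _ (ae_filter_ringOfSetsType leb) _ _ _ aeV) => p Hp _; rewrite /fubini_F Hp.
Qed.

End SphereUniqueness.

(** * Green kernels *)

Section SphericalKernel.
Context {R : realType} (k : R).
Implicit Types (s z : R) (F E : R -> R).

(** For [F = cos] and [F = sin] these are the real and imaginary parts of the conjugate kernel in
    dimension 3. [wave1] is the derivative in [s] when [E] is the derivative of [F]. *)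
Definition wave0 F s : R := F (k * Num.sqrt s) / (4 * pi * Num.sqrt s).
Definition wave1 F E s : R :=
  (k * Num.sqrt s * E (k * Num.sqrt s) - F (k * Num.sqrt s)) / (8 * pi * Num.sqrt s ^+ 3).

Lemma wave_radial F E :
  (forall z, is_derive z (1:R) F (E z)) -> (forall z, is_derive z (1:R) E (- F z)) ->
  radial 3 k (radial_seq 3 k (wave0 F) (wave1 F E)).
Proof.
move=> dF dE.
have pin : pi != 0 :> R by rewrite gt_eqF // pi_gt0.
have qn s : 0 < s -> Num.sqrt s != 0 by move=> s0; rewrite gt_eqF // sqrtr_gt0.
have sE s : 0 < s -> s = Num.sqrt s ^+ 2 by move=> s0; rewrite sqr_sqrtr // ltW.
have dq s : 0 < s -> is_derive s (1:R) (Num.sqrt : R -> R) (2 * Num.sqrt s)^-1.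
  by move=> s0; exact: is_derive1_sqrt.
have dkq s : 0 < s -> is_derive s (1:R) (fun t => k * Num.sqrt t) (k * (2 * Num.sqrt s)^-1).
  by move=> s0; apply: derZ; exact: dq.
have dFk s : 0 < s -> is_derive s (1:R) (fun t => F (k * Num.sqrt t))
    (E (k * Num.sqrt s) * (k * (2 * Num.sqrt s)^-1)).
  by move=> s0; exact: (der_comp (g := fun t => k * Num.sqrt t) (dF _) (dkq s s0)).
have dEk s : 0 < s -> is_derive s (1:R) (fun t => E (k * Num.sqrt t))
    (- F (k * Num.sqrt s) * (k * (2 * Num.sqrt s)^-1)).
  by move=> s0; exact: (der_comp (g := fun t => k * Num.sqrt t) (dE _) (dkq s s0)).
apply: radial_seqP => s s0; have := qn s s0 => q0.
- have n1 : 4 * pi * Num.sqrt s != 0 by rewrite !mulf_neq0.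
  apply: der_eq (derM (dFk s s0)
    (derV (f := fun t => 4 * pi * Num.sqrt t) n1 (derZ (4 * pi) (dq s s0)))) _ _ => //.
  rewrite /wave1; move: (F _) (E _) => f e; move: pin q0 {n1}; move: (@pi R) (Num.sqrt s) => p q p0 q0.
  by field; rewrite q0 p0.
- have n1 : 8 * pi * Num.sqrt s ^+ 3 != 0 by rewrite !mulf_neq0 // expf_neq0.
  apply: der_eq (derM (derD (derM (dkq s s0) (dEk s s0))
     (derN (dFk s s0)))
    (derV (f := fun t => 8 * pi * Num.sqrt t ^+ 3) n1 (derZ (8 * pi) (derXn 3 (dq s s0))))) _ _ => //.
  rewrite /wave0 /wave1 [in RHS](_ : 4 * s = 4 * Num.sqrt s ^+ 2); last by rewrite -sE.
  move: (F _) (E _) => f e; move: pin q0 {n1}; move: (@pi R) (Num.sqrt s) => p q p0 q0.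
  by rewrite /=; field; rewrite q0 p0.
Qed.

End SphericalKernel.

(** * The power series in [J_0] and [Y_0], their equations and their Wronskian *)

Section BesselSeries.
Context {R : realType}.
Implicit Types (c : nat -> R) (x : R).

Definition psum c x : R := limn (pseries c x).

(** Domination by an exponential series gives convergence everywhere, and it survives formal
    differentiation since [m.+1 / m.+1! = 1 / m!]; termwise differentiation can thus be iterated. *)
Definition exp_bounded c : Prop := exists C : R, forall m, `|c m| <= C / m`!%:R.

Lemma exp_bounded_cvg c : exp_bounded c -> forall x, cvgn (pseries c x).
Proof.
move=> [C cC] x; apply: normed_cvg.
apply: (@series_le_cvg _ _ (fun m => C * (exp_coeff `|x| m))) => [m|m|m|].
- exact: normr_ge0.
- rewrite mulr_ge0 //; last by rewrite /exp_coeff /= divr_ge0 ?exprn_ge0.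
  by have := cC 0%N; rewrite fact0 divr1; exact: le_trans.
- rewrite /= normrM normrX /exp_coeff /= mulrA mulrAC.
  by apply: ler_wpM2r; [exact: exprn_ge0|exact: cC].
- rewrite -[X in cvgn (series X)]/(C *: exp_coeff `|x|).
  by apply: is_cvg_seriesZ; exact: is_cvg_series_exp_coeff.
Qed.

Lemma exp_bounded_diffs c : exp_bounded c -> exp_bounded (pseries_diffs c).
Proof.
move=> [C cC]; exists C => m; rewrite /pseries_diffs normrM ger0_norm //.
apply: le_trans (ler_wpM2l _ (cC m.+1)) _ => //.
have f0 : m`!%:R != 0 :> R by rewrite pnatr_eq0 -lt0n fact_gt0.
have m0 : m.+1%:R != 0 :> R by [].
rewrite factS natrM le_eqVlt; apply/orP; left; apply/eqP.
move: f0 m0; move: (m`!%:R) (m.+1%:R) => p q p0 q0; field.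
by rewrite p0 q0.
Qed.

Lemma psum_derive c x : exp_bounded c ->
  is_derive x (1:R) (psum c) (psum (pseries_diffs c) x).
Proof.
move=> bc; apply: (@pseries_snd_diffs _ _ (`|x| + 1)).
- exact: exp_bounded_cvg.
- exact/exp_bounded_cvg/exp_bounded_diffs.
- exact/exp_bounded_cvg/exp_bounded_diffs/exp_bounded_diffs.
- by rewrite [ltRHS]ger0_norm ?addr_ge0 // ltrDl.
Qed.

Lemma psum_shift c x : cvgn (pseries (fun m => c m.+1) x) ->
  pseries c x @ \oo --> c 0%N + x * psum (fun m => c m.+1) x.
Proof.
move=> cvs; rewrite -cvg_shiftS.
have -> : [sequence pseries c x n.+1]_n = (fun n => c 0%N + x * pseries (fun m => c m.+1) x n).
  apply/funext => n; rewrite /pseries /series /= big_nat_recl //= expr0 mulr1 mulr_sumr.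
  by congr (_ + _); apply: eq_bigr => i _; rewrite exprS mulrCA.
by apply: cvgD; [exact: cvg_cst|apply: cvgMl_tmp].
Qed.

Lemma psumD c e x : cvgn (pseries c x) -> cvgn (pseries e x) ->
  psum c x + psum e x = psum (fun m => c m + e m) x.
Proof.
move=> bc be; apply/esym; rewrite /psum /pseries -(lim_seriesD bc be).
by congr (limn (series _)); apply/funext => m; rewrite /= mulrDl.
Qed.

(** The operator [x g'' + g'], the main part of the Bessel equation in the variable
    [x = (z / 2) ^ 2], only shifts and rescales coefficients: [m * m.+1 + m.+1 = m.+1 ^ 2]. *)
Lemma psum_second x c : exp_bounded c ->
  x * psum (pseries_diffs (pseries_diffs c)) x + psum (pseries_diffs c) x =
  psum (fun m => m.+1%:R ^+ 2 * c m.+1) x.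
Proof.
move=> bc; have b1 := exp_bounded_diffs bc; have b2 := exp_bounded_diffs b1.
pose e m := m%:R * pseries_diffs c m.
have cve : pseries e x @ \oo --> x * psum (pseries_diffs (pseries_diffs c)) x.
  have H : cvgn (pseries (fun m => e m.+1) x) by exact: (exp_bounded_cvg b2).
  have := psum_shift H.
  by rewrite (_ : e 0%N = 0) ?add0r // /e mul0r.
rewrite -(cvg_lim _ cve) // -/(psum e x) psumD; last 2 first.
- by apply/cvg_ex; eexists; exact: cve.
- exact: exp_bounded_cvg.
by congr psum; apply/funext => m; rewrite /e /pseries_diffs -natr1; ring.
Qed.

Lemma psum0 c : psum c 0 = c 0%N.
Proof.
apply: cvg_lim => //; rewrite -cvg_shiftS.
have -> : [sequence pseries c 0 n.+1]_n = (fun=> c 0%N).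
  apply/funext => n; rewrite /pseries /series /= big_nat_recl //= expr0 mulr1.
  by rewrite big1 ?addr0 // => i _; rewrite expr0n mulr0.
exact: cvg_cst.
Qed.

(* With [x = (z / 2) ^ 2], [jcoef] and [acoef] are the coefficients in [x] of [J_0 z]
   and of the power series part of [(pi / 2) Y_0 z]. *)
Definition jcoef (m : nat) : R := (-1) ^+ m / m`!%:R ^+ 2.
Definition acoef (m : nat) : R := (-1) ^+ m.+1 * Defs.harmonic R m / m`!%:R ^+ 2.

Lemma sign_norm m : `|(-1) ^+ m| = 1 :> R.
Proof. by rewrite normrX normrN1 expr1n. Qed.

Lemma factR_neq0 m : m`!%:R != 0 :> R.
Proof. by rewrite pnatr_eq0 -lt0n fact_gt0. Qed.

Lemma jcoef_bounded : exp_bounded jcoef.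
Proof.
exists 1 => m; rewrite /jcoef normrM sign_norm !mul1r ger0_norm ?invr_ge0 ?exprn_ge0 //.
rewrite lef_pV2 ?posrE ?exprn_gt0 ?ltr0n ?fact_gt0 // -natrX ler_nat.
by rewrite expnS expn1 leq_pmull // fact_gt0.
Qed.

Lemma harmonic_bounds m : 0 <= Defs.harmonic R m <= m%:R.
Proof.
rewrite /Defs.harmonic; apply/andP; split; first by apply: sumr_ge0 => i _; rewrite invr_ge0.
rewrite -[leRHS](_ : \sum_(j < m) 1 = m%:R); last by rewrite sumr_const card_ord.
by apply: ler_sum => i _; rewrite invf_le1 // ler1n.
Qed.

Lemma acoef_bounded : exp_bounded acoef.
Proof.
exists 1 => m; have /andP[h0 hm] := harmonic_bounds m.
rewrite /acoef !normrM sign_norm !mul1r (ger0_norm h0) ger0_norm ?invr_ge0 ?exprn_ge0 //.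
have f0 : 0 < m`!%:R :> R by rewrite ltr0n fact_gt0.
rewrite ler_pdivrMr ?exprn_gt0 // expr2 mulrA mulVf ?gt_eqF // mul1r.
apply: le_trans hm _; rewrite ler_nat; elim: m {h0 f0} => // m IH.
by rewrite factS -[leqLHS]muln1 leq_mul // fact_gt0.
Qed.

Definition jser i : R -> R := psum (iter i (@pseries_diffs R) jcoef).
Definition aser i : R -> R := psum (iter i (@pseries_diffs R) acoef).

Lemma iter_bounded i c : exp_bounded c -> exp_bounded (iter i (@pseries_diffs R) c).
Proof. by move=> bc; elim: i => //= i; exact: exp_bounded_diffs. Qed.

Lemma jser_derive i x : is_derive x (1:R) (jser i) (jser i.+1 x).
Proof. by apply: psum_derive; apply: iter_bounded; exact: jcoef_bounded. Qed.

Lemma aser_derive i x : is_derive x (1:R) (aser i) (aser i.+1 x).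
Proof. by apply: psum_derive; apply: iter_bounded; exact: acoef_bounded. Qed.

Lemma psumN c x : exp_bounded c -> psum (fun m => - c m) x = - psum c x.
Proof.
move=> bc; apply: cvg_lim => //.
have -> : pseries (fun m => - c m) x = (fun n => - pseries c x n).
  apply/funext => n; rewrite /pseries /series /= -sumrN.
  by apply: eq_bigr => i _; rewrite mulNr.
by apply: cvgN; exact: exp_bounded_cvg.
Qed.

Lemma jser_ode x : x * jser 2 x + jser 1 x + jser 0 x = 0.
Proof.
rewrite /jser /= (psum_second x jcoef_bounded).
rewrite -[X in _ + X]opprK -psumN; last exact: jcoef_bounded.
apply/eqP; rewrite subr_eq0; apply/eqP; congr psum; apply/funext => m.
have := factR_neq0 m => f0; have m0 : m.+1%:R != 0 :> R by [].
rewrite /jcoef factS natrM (exprS (-1)).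
by move: f0 m0; move: (m`!%:R) (m.+1%:R) => p q p0 q0; field; rewrite p0 q0.
Qed.

(** The source term comes from the increment [1 / m.+1] of the harmonic numbers. It compensates the
    logarithm: applying [x g'' + g' + g] to [2^-1 * ln x * jser 0 x] gives [jser 1 x]. *)
Lemma aser_ode x : x * aser 2 x + aser 1 x + aser 0 x = - jser 1 x.
Proof.
rewrite /aser /jser /= (psum_second x acoef_bounded).
have bj := exp_bounded_diffs jcoef_bounded.
rewrite -psumN // [psum acoef x]/(psum acoef x).
have E : (fun m => m.+1%:R ^+ 2 * acoef m.+1) = (fun m => - pseries_diffs jcoef m + (- acoef m)).
  apply/funext => m; rewrite /pseries_diffs /acoef /jcoef /Defs.harmonic big_ord_recr /=.
  have := factR_neq0 m => f0; have m0 : m.+1%:R != 0 :> R by [].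
  rewrite factS natrM !(exprS (-1)); move: (\sum_(_ < _) _) => H.
  by move: f0 m0; move: (m`!%:R) (m.+1%:R) => p q p0 q0; field; rewrite p0 q0.
have bN c : exp_bounded c -> exp_bounded (fun m => - c m).
  by move=> [C cC]; exists C => m; rewrite normrN.
rewrite E -psumD.
- by rewrite !psumN ?addrNK //; exact: acoef_bounded.
- by apply: exp_bounded_cvg; exact: bN.
- by apply: exp_bounded_cvg; apply: bN; exact: acoef_bounded.
Qed.

(** The left side is [x] times the Wronskian of [jser 0] and [bessel_y0], in which the logarithms
    cancel. It is therefore defined on the whole line, has zero derivative by the two equations, and
    can be evaluated at 0. *)
Lemma bessel_wronskian x :
  2^-1 * jser 0 x ^+ 2 + x * (jser 0 x * aser 1 x - jser 1 x * aser 0 x) = 2^-1.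
Proof.
pose F y := 2^-1 * jser 0 y ^+ 2 + y * (jser 0 y * aser 1 y - jser 1 y * aser 0 y).
have F0 : F 0 = 2^-1.
  have j00 : jser 0 0 = 1 by rewrite /jser psum0 /= /jcoef expr0 fact0 expr1n divr1.
  by rewrite /F mul0r addr0 j00 expr1n mulr1.
rewrite -[LHS]/(F x) -F0; apply: is_derive_0_is_cst => y.
have J0 := jser_derive 0 y; have J1 := jser_derive 1 y.
have A0 := aser_derive 0 y; have A1 := aser_derive 1 y.
apply: der_eq (derD (derZ (2^-1) (derXn 2 J0)) (derM (is_derive_id y 1)
  (derD (derM J0 A1) (derN (derM J1 A0))))) _ _ => //.
have := jser_ode y; have := aser_ode y.
move: (jser 0 y) (jser 1 y) (jser 2 y) (aser 0 y) (aser 1 y) (aser 2 y).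
move=> j0 j1 j2 a0 a1 a2 Ea Ej; rewrite /= expr1.
transitivity (j0 * (y * a2 + a1 + a0 + j1) - a0 * (y * j2 + j1 + j0)); first by field.
by rewrite Ea Ej; ring.
Qed.

End BesselSeries.

(** * The logarithmic solution and the kernel in dimension 2 *)

Section CircularKernel.
Context {R : realType} (k : R).
Context (k0 : 0 < k).
Implicit Types (s x z : R).

(** [(pi / 2) * Y_0 z] for [z > 0] and [x = (z / 2) ^ 2], where [2^-1 * ln x] is [ln (z / 2)]. *)
Definition bessel_y0 x : R := (2^-1 * ln x + @euler_gamma R) * jser 0 x + aser 0 x.
Definition bessel_y1 x : R :=
  jser 0 x / (2 * x) + (2^-1 * ln x + @euler_gamma R) * jser 1 x + aser 1 x.

Lemma bessel_y0_derive x : 0 < x -> is_derive x (1:R) bessel_y0 (bessel_y1 x).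
Proof.
move=> x0; have x1 : x != 0 by rewrite gt_eqF.
apply: der_eq (derD (derM (derD (derZ (2^-1) (is_derive1_ln x0)) (derC (@euler_gamma R) x))
  (jser_derive 0 x)) (aser_derive 0 x)) _ _ => //.
rewrite /bessel_y1; move: (euler_gamma _) (ln x) => g l.
by field.
Qed.

Lemma jser_second x : x != 0 -> jser 2 x = - (jser 1 x + jser 0 x) / x.
Proof.
move=> x0; apply: (mulfI x0); rewrite mulrCA divff // mulr1.
by apply/eqP; rewrite -subr_eq0 opprK addrA jser_ode.
Qed.

Lemma aser_second x : x != 0 -> aser 2 x = - (aser 1 x + aser 0 x + jser 1 x) / x.
Proof.
move=> x0; apply: (mulfI x0); rewrite mulrCA divff // mulr1.
by apply/eqP; rewrite -subr_eq0 opprK !addrA aser_ode addrC subrr.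
Qed.

Lemma bessel_y1_derive x : 0 < x ->
  is_derive x (1:R) bessel_y1 (- (bessel_y1 x + bessel_y0 x) / x).
Proof.
move=> x0; have x1 : x != 0 by rewrite gt_eqF.
have x2 : 2 * x != 0 by rewrite mulf_neq0.
apply: der_eq (derD (derD (derM (jser_derive 0 x)
    (derV (f := fun t => 2 * t) x2 (derZ 2 (is_derive_id x 1))))
  (derM (derD (derZ (2^-1) (is_derive1_ln x0)) (derC (@euler_gamma R) x))
  (jser_derive 1 x))) (aser_derive 1 x)) _ _ => //.
rewrite /bessel_y1 /bessel_y0 jser_second // aser_second //.
move: (euler_gamma _) (ln x) => g l.
by field.
Qed.

(** For [z = k * sqrt s] the variable [(z / 2) ^ 2] of the Bessel series is [kap * s]. *)
Let kap : R := k ^+ 2 / 4.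

Lemma kap_gt0 : 0 < kap. Proof. by rewrite divr_gt0 // exprn_gt0. Qed.

Definition circ0 (c : R) (f0 : R -> R) s : R := c * f0 (kap * s).
Definition circ1 (c : R) (f1 : R -> R) s : R := c * kap * f1 (kap * s).

Lemma circ_radial (c : R) (f0 f1 : R -> R) :
  (forall x, 0 < x -> is_derive x (1:R) f0 (f1 x)) ->
  (forall x, 0 < x -> is_derive x (1:R) f1 (- (f1 x + f0 x) / x)) ->
  radial 2 k (radial_seq 2 k (circ0 c f0) (circ1 c f1)).
Proof.
move=> d0 d1; have kp := kap_gt0; have kn : kap != 0 by rewrite gt_eqF.
have dk s : is_derive s (1:R) (fun t => kap * t) kap.
  by apply: der_eq (derZ kap (is_derive_id s 1)) _ _ => //; rewrite mulr1.
have kE : k ^+ 2 = 4 * kap by rewrite /kap; field.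
apply: radial_seqP => s s0; have ks : 0 < kap * s by rewrite mulr_gt0.
- apply: der_eq (derZ c (der_comp (g := fun t => kap * t) (d0 _ ks) (dk s))) _ _ => //.
  by rewrite /circ1; ring.
- apply: der_eq (derZ (c * kap) (der_comp (g := fun t => kap * t) (d1 _ ks) (dk s))) _ _ => //.
  rewrite /circ0 /circ1 kE; have s1 : s != 0 by rewrite gt_eqF.
  move: kn; move: kap (f0 _) (f1 _) => q f e q0; field.
  by rewrite q0 s1.
Qed.

Lemma besselJ0E z : besselJ0 z = jser 0 ((z / 2) ^+ 2).
Proof.
rewrite /besselJ0 /jser /psum /pseries; congr (limn (series _)); apply/funext => m.
by rewrite /= /jcoef exprM mulrAC.
Qed.

Lemma besselY0E z : 0 < z -> besselY0 z = 2 / pi * bessel_y0 ((z / 2) ^+ 2).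
Proof.
move=> z0; have z2 : 0 < z / 2 by rewrite divr_gt0.
rewrite /besselY0 /bessel_y0 -besselJ0E lnXn //; congr (_ * (_ * _ + _)).
  by rewrite -(mulr_natl (ln _) 2) mulKf.
set x := (z / 2) ^+ 2.
have cv : pseries acoef x @ \oo --> psum acoef x by exact: (exp_bounded_cvg acoef_bounded).
apply: cvg_lim => //.
(* The series for [Y_0] starts at index 1, whereas [acoef] starts at 0 with a zero coefficient, so
   the partial sums differ by a shift of one. *)
have -> : series (fun m : nat => (-1) ^+ m.+2 * @Defs.harmonic R m.+1 * (z / 2) ^+ (2 * m.+1)
    / m.+1`!%:R ^+ 2) = [sequence pseries acoef x n.+1]_n.
  apply/funext => n; rewrite /pseries /series /= big_nat_recl //=.
  have -> : acoef 0 = 0 :> R by rewrite /acoef /Defs.harmonic big_ord0 mulr0 mul0r.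
  rewrite mul0r add0r.
  by apply: eq_bigr => m _; rewrite /acoef exprM mulrAC.
by rewrite cvg_shiftS; exact: cv.
Qed.

End CircularKernel.

(** The interface between the dimension-specific kernels and the argument common to both
    dimensions. *)
Record helmholtz_kernel {R : realType} (N : nat) (k : R) (A B : nat -> R -> R) : Prop := HelmholtzKernel {
  kernel_radialRe : radial N k A;
  kernel_radialIm : radial N k B;
  kernel_wronskian : forall s : R, 0 < s ->
    A 0%N s * B 1%N s - A 1%N s * B 0%N s != 0;
  kernel_green : forall x y : 'rV[R]_N, 0 < sqn (x - y) ->
    (green k x y)^* = Complex (A 0%N (sqn (x - y))) (B 0%N (sqn (x - y))) }.

Lemma kernel_circle (R : realType) (k : R) : 0 < k -> exists A B, helmholtz_kernel 2 k A B.
Proof.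
move=> k0; have pin : pi != 0 :> R by rewrite gt_eqF // pi_gt0.
(* The conjugate of [i / 4 * (J_0 + i Y_0)] is [- Y_0 / 4 - i J_0 / 4], and [Y_0] is [2 / pi] times
   [bessel_y0]. *)
exists (radial_seq 2 k (circ0 k (- (2 * pi)^-1) (@bessel_y0 R)) (circ1 k (- (2 * pi)^-1) (@bessel_y1 R))).
exists (radial_seq 2 k (circ0 k (- 4^-1) (@jser R 0)) (circ1 k (- 4^-1) (@jser R 1))).
split.
- by apply: circ_radial => // x x0; [exact: bessel_y0_derive|exact: bessel_y1_derive].
- apply: circ_radial => // x x0; first exact: jser_derive.
  by apply: der_eq (jser_derive 1 x) _ _ => //; rewrite jser_second // gt_eqF.
- move=> s s0; rewrite /= /circ0 /circ1.
  have kp := kap_gt0 k0; set q := k ^+ 2 / 4 in kp *.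
  have := mulr_gt0 kp s0; set x := q * s => x0.
  have x1 : x != 0 by rewrite gt_eqF.
  have q0 : q != 0 by rewrite gt_eqF.
  have W := bessel_wronskian x.
  rewrite /bessel_y0 /bessel_y1; move: W.
  move: (euler_gamma _) (ln x) (jser 0 x) (jser 1 x) (aser 0 x) (aser 1 x) => g l j0 j1 a0 a1 W.
  have -> : - (2 * pi)^-1 * ((2^-1 * l + g) * j0 + a0) * (- 4^-1 * q * j1) -
     - (2 * pi)^-1 * q * (j0 / (2 * x) + (2^-1 * l + g) * j1 + a1) * (- 4^-1 * j0)
    = - q / (8 * pi * x) * (2^-1 * j0 ^+ 2 + x * (j0 * a1 - j1 * a0)).
    move: pin x1; clear W; move: (@pi R) => p p0 x1; field.
    by rewrite p0 x1.
  have e1 : 8 * pi * x != 0 by apply: mulf_neq0 => //; apply: mulf_neq0.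
  have e2 : (2 : R)^-1 != 0 by rewrite invr_eq0.
  by rewrite W; apply: mulf_neq0 => //; apply: mulf_neq0; rewrite ?oppr_eq0 ?invr_eq0.
- move=> x y; set s := sqn (x - y) => s0 /=.
  rewrite /circ0 /green /= /hankel01 [eucl_norm _]/(Num.sqrt s).
  have q0 : 0 < Num.sqrt s by rewrite sqrtr_gt0.
  rewrite besselJ0E besselY0E ?mulr_gt0 //.
  have -> : (k * Num.sqrt s / 2) ^+ 2 = k ^+ 2 / 4 * s.
    by rewrite !exprMn sqr_sqrtr ?(ltW s0) // exprVn; field.
  move: (jser 0 _) (bessel_y0 _) => j b.
  apply/eqP; rewrite eq_complex /=; apply/andP; split; apply/eqP.
    have -> : 1 + (1 + (1 + 1)) = 4 :> R by ring.
    rewrite !addr0; move: pin; move: (@pi R) => p p0; field.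
    by rewrite p0.
  have -> : 1 + (1 + (1 + 1)) = 4 :> R by ring.
  rewrite !addr0; move: pin; move: (@pi R) => p p0; field.
  by rewrite p0.
Qed.

Lemma kernel_sphere (R : realType) (k : R) : 0 < k -> exists A B, helmholtz_kernel 3 k A B.
Proof.
move=> k0; have pin : pi != 0 :> R by rewrite gt_eqF // pi_gt0.
exists (radial_seq 3 k (wave0 k cos) (wave1 k cos (fun z => - sin z))).
exists (radial_seq 3 k (wave0 k sin) (wave1 k sin cos)).
split.
- by apply: wave_radial => z; exact: derN.
- exact: wave_radial.
- move=> s s0; rewrite /= /wave0 /wave1.
  have q0 : Num.sqrt s != 0 by rewrite gt_eqF // sqrtr_gt0.
  have := cos2Dsin2 (k * Num.sqrt s).
  move: (cos _) (sin _) => c e ce.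
  move: q0; move: (Num.sqrt s) => q q0.
  have -> : c / (4 * pi * q) * ((k * q * c - e) / (8 * pi * q ^+ 3)) -
     (k * q * - e - c) / (8 * pi * q ^+ 3) * (e / (4 * pi * q))
    = (c ^+ 2 + e ^+ 2) * (k / (32 * pi ^+ 2 * q ^+ 3)).
    move: pin; move: (@pi R) => p p0; field.
    by rewrite p0 q0.
  have e1 : 32 * pi ^+ 2 * q ^+ 3 != 0.
    by apply: mulf_neq0; [apply: mulf_neq0 => //|]; exact: expf_neq0.
  by rewrite ce mul1r; apply: mulf_neq0; rewrite ?invr_eq0 // gt_eqF.
- move=> x y; set s := sqn (x - y) => s0 /=.
  rewrite /wave0 /green /= [eucl_norm _]/(Num.sqrt s).
  have : 4 * pi * Num.sqrt s != 0.
    by apply: mulf_neq0; [apply: mulf_neq0|rewrite gt_eqF // sqrtr_gt0].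
  move: (cos _) (sin _) (4 * pi * Num.sqrt s) => c e p p0.
  apply/eqP; rewrite eq_complex /=; apply/andP; split; apply/eqP.
    by field; rewrite p0.
  by field; rewrite p0.
Qed.

(** * Densities on the circle and on the sphere *)

Section SurfaceMoments.
Context d (T : measurableType d) {R : realType} (mu : {measure set T -> \bar R}).
Context (D : set T) (mD : measurable D) (N : nat) (y : T -> 'rV[R]_N) (r k : R).
Context (my : forall i, measurable_fun D (fun t => y t ord0 i)).
Context (r0 : 0 < r) (k0 : 0 < k) (yr : forall t, D t -> sqn (y t) = r ^+ 2).
Context (A B : nat -> R -> R) (hK : helmholtz_kernel N k A B).
Context (w : T -> R) (iw : rintegrable mu D w) (w0 : forall t, D t -> 0 <= w t).
Implicit Types (u : T -> R[i]) (x : 'rV[R]_N).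

Local Notation L1 := (rintegrable mu D).

Definition weighted_L2 u : Prop :=
  [/\ measurable_fun D (fun t => complex.Re (u t)),
      measurable_fun D (fun t => complex.Im (u t)) &
      (\int[mu]_(t in D) ((sqmod (u t))%:E * (w t)%:E) < +oo)%E].

(** The weighted measure is finite, so square integrability implies integrability through
    [|f| <= 1 + f ^ 2]. *)
Lemma weighted_L1 (f : T -> R) (q : T -> R) : measurable_fun D f -> measurable_fun D q ->
  (forall t, D t -> f t ^+ 2 <= q t) ->
  (\int[mu]_(t in D) ((q t)%:E * (w t)%:E) < +oo)%E ->
  L1 (fun t => f t * w t).
Proof.
move=> mf mq fq qoo; have mw := rintegrable_measurable iw.
have iq : L1 (fun t => q t * w t).
  apply/integrableP; split; first exact/measurable_EFinP/measurable_funM.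
  apply: le_lt_trans qoo; rewrite le_eqVlt; apply/orP; left; apply/eqP.
  apply: eq_integral => t; rewrite inE => Dt; rewrite /= -EFinM ger0_norm //.
  by rewrite mulr_ge0 ?w0 // (le_trans (sqr_ge0 (f t))) // fq.
apply: (rintegrable_le mD (g := fun t => w t + q t * w t)).
- exact: measurable_funM.
- move=> t Dt; rewrite normrM (ger0_norm (w0 Dt)) -[X in X + _]mul1r -mulrDl.
  apply: ler_wpM2r; first exact: w0.
  have h := fq t Dt; have := sqr_ge0 (`|f t| - 1); have h2 := real_normK (num_real (f t)).
  have := normr_ge0 (f t); move: h2; rewrite -(real_normK (num_real (f t))) in h.
  by move=> _; nra.
- exact: rintegrableD.
Qed.

Lemma weighted_L2_L1 u : weighted_L2 u ->
  L1 (fun t => complex.Re (u t) * w t) /\ L1 (fun t => complex.Im (u t) * w t).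
Proof.
move=> [m1 m2 uoo].
have mq : measurable_fun D (fun t => sqmod (u t)).
  by rewrite /sqmod; apply: measurable_funD; exact: measurable_funX.
split; [apply: (weighted_L1 m1 mq) | apply: (weighted_L1 m2 mq)] => // t _.
  by rewrite /sqmod lerDl sqr_ge0.
by rewrite /sqmod lerDr sqr_ge0.
Qed.

Definition surface_potential u x : R * R :=
  (fine (\int[mu]_(t in D) ((complex.Re (u t * (green k x (y t))^*))%:E * (w t)%:E))%E,
   fine (\int[mu]_(t in D) ((complex.Im (u t * (green k x (y t))^*))%:E * (w t)%:E))%E).

(** Complex multiplication splits one complex potential into two real ones, with density pairs
    [(U, -V)] and [(V, U)] for [U + i V = u * w]. *)
Lemma surface_potentialE u x : sqn x < r ^+ 2 ->
  surface_potential u x =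
  (potential mu D y A B (fun t => complex.Re (u t) * w t) (fun t => - (complex.Im (u t) * w t)) x,
   potential mu D y A B (fun t => complex.Im (u t) * w t) (fun t => complex.Re (u t) * w t) x).
Proof.
move=> xr; have pos t : D t -> 0 < sqn (x - y t).
  move=> Dt; have a0 := sqrtr_ge0 (sqn x).
  have ar : Num.sqrt (sqn x) < r.
    by rewrite -(ltr_pXn2r (n := 2)) ?nnegrE ?(ltW r0) // sqr_sqrtr ?sqn_ge0.
  have := dist_bounds a0 ar (_ : sqn x <= Num.sqrt (sqn x) ^+ 2) (yr Dt).
  rewrite sqr_sqrtr ?sqn_ge0 // lexx => /(_ isT) /andP[+ _].
  by apply: lt_le_trans; rewrite exprn_gt0 // subr_gt0.
congr pair; congr fine; apply: eq_integral => t; rewrite inE => Dt;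
  rewrite (kernel_green hK (pos t Dt)) -EFinM; congr (_%:E);
  case: (u t) => a b /=; ring.
Qed.

Lemma potentialB (P1 Q1 P2 Q2 : T -> R) x : sqn x < r ^+ 2 ->
  L1 P1 -> L1 Q1 -> L1 P2 -> L1 Q2 ->
  potential mu D y A B P1 Q1 x = potential mu D y A B P2 Q2 x ->
  potential mu D y A B (fun t => P1 t - P2 t) (fun t => Q1 t - Q2 t) x = 0.
Proof.
move=> xr i1 j1 i2 j2 E.
have rA := kernel_radialRe hK; have rB := kernel_radialIm hK.
have a0 := sqrtr_ge0 (sqn x).
have ar : Num.sqrt (sqn x) < r.
  by rewrite -(ltr_pXn2r (n := 2)) ?nnegrE ?(ltW r0) // sqr_sqrtr ?sqn_ge0.
have d0 : 0 < (r - Num.sqrt (sqn x)) ^+ 2 by rewrite exprn_gt0 // subr_gt0.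
have bnd t : D t -> (r - Num.sqrt (sqn x)) ^+ 2 <= sqn (x - y t) <= (r + Num.sqrt (sqn x)) ^+ 2.
  move=> Dt; apply: dist_bounds => //; first by rewrite sqr_sqrtr ?sqn_ge0.
  exact: yr.
have iP P g : radial N k g -> L1 P -> L1 (fun t => P t * g 0%N (sqn (x - y t))).
  by move=> rg iP; apply: (kernel_integrable mD my 0 rg iP d0 bnd).
have iPQ P Q : L1 P -> L1 Q ->
    L1 (fun t => P t * A 0%N (sqn (x - y t)) + Q t * B 0%N (sqn (x - y t))).
  by move=> p q; apply: rintegrableD => //; exact: iP.
apply: (@etrans _ _ (potential mu D y A B P1 Q1 x - potential mu D y A B P2 Q2 x)); last first.
  by rewrite E subrr.
rewrite /potential -(RintegralB mD (iPQ _ _ i1 j1) (iPQ _ _ i2 j2)).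
by apply: Rintegral_eq => t _; ring.
Qed.

Lemma surface_moments u1 u2 (Omega : set 'rV[R]_N) :
  open Omega -> Omega !=set0 -> Omega `<=` @eball R N r ->
  weighted_L2 u1 -> weighted_L2 u2 ->
  (forall x, Omega x -> surface_potential u1 x = surface_potential u2 x) ->
  let U t := (complex.Re (u1 t) - complex.Re (u2 t)) * w t in
  let V t := (complex.Im (u1 t) - complex.Im (u2 t)) * w t in
  [/\ L1 U, L1 V & forall v m, \int[mu]_(t in D) (U t * dotp v (y t) ^+ m) = 0 /\
                               \int[mu]_(t in D) (V t * dotp v (y t) ^+ m) = 0].
Proof.
move=> oO [x0 Ox0] Or h1 h2 E U V.
have [iU1 iV1] := weighted_L2_L1 h1; have [iU2 iV2] := weighted_L2_L1 h2.
have rA := kernel_radialRe hK; have rB := kernel_radialIm hK.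
have inr x : Omega x -> sqn x < r ^+ 2.
  move=> /Or; rewrite /eball /= => xr.
  by rewrite -[sqn x]sqr_sqrtr ?sqn_ge0 // ltrXn2r // ?nnegrE ?sqrtr_ge0 // ltW.
have iU : L1 U by apply: rintegrable_eq (rintegrableB mD iU1 iU2) => // t _; rewrite /U mulrBl.
have iV : L1 V by apply: rintegrable_eq (rintegrableB mD iV1 iV2) => // t _; rewrite /V mulrBl.
(* Neighbourhoods are max-norm balls; [sqn v <= 1] bounds every coordinate of [v] by 1, so the
   radius [e] itself serves as [eps]. *)
have line v : sqn v <= 1 -> exists2 eps, 0 < eps &
    forall tau, `|tau| < eps -> Omega (x0 + tau *: v).
  move=> v1; have : nbhs x0 Omega by exact: open_nbhs_nbhs.
  move=> /nbhs_ballP[e /= e0 He]; exists e => // tau taue; apply: He.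
  split => // i j; rewrite (ord1 i) /ball /= !mxE opprD addNKr normrN normrM.
  apply: le_lt_trans taue; rewrite ler_piMr //.
  rewrite -(ler_pXn2r (n := 2)) ?nnegrE // expr1n real_normK ?num_real //.
  apply: le_trans v1; rewrite /sqn (bigD1 j) //= lerDl.
  by apply: sumr_ge0 => l _; exact: sqr_ge0.
have pot x : Omega x -> potential mu D y A B U (fun t => - V t) x = 0 /\
    potential mu D y A B V U x = 0.
  move=> Ox; have := E x Ox; rewrite !surface_potentialE ?inr // => -[E1 E2].
  have p1 := potentialB (inr x Ox) iU1 (rintegrableN iV1) iU2 (rintegrableN iV2) E1.
  have p2 := potentialB (inr x Ox) iV1 iU1 iV2 iU2 E2.
  split; [rewrite -[RHS]p1|rewrite -[RHS]p2]; apply: Rintegral_eq => t _;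
    rewrite /U /V; ring.
split=> // v m.
apply: (moments_vanish mD my r0 yr rA rB iU iV _ _ (inr _ Ox0)).
- by rewrite gt_eqF.
- by apply: (kernel_wronskian hK); rewrite exprn_gt0.
- by move=> v' /line[eps eps0 H]; exists eps => // tau /H /pot[].
- by move=> v' /line[eps eps0 H]; exists eps => // tau /H /pot[].
Qed.

(** The hypotheses keep the factor [w t], which vanishes at the poles of the sphere; it is also a
    factor of the integrand, so no division is required. *)
Lemma surface_ae_eq u1 u2 : weighted_L2 u1 -> weighted_L2 u2 ->
  {ae mu, forall t, D t -> (complex.Re (u1 t) - complex.Re (u2 t)) * w t = 0} ->
  {ae mu, forall t, D t -> (complex.Im (u1 t) - complex.Im (u2 t)) * w t = 0} ->
  (\int[mu]_(t in D) ((sqmod (u1 t - u2 t))%:E * (w t)%:E) = 0)%E.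
Proof.
move=> [m1 n1 _] [m2 n2 _] aU aV.
rewrite -[RHS](@integral0 _ _ _ mu D); apply: ae_eq_integral => //.
  apply/measurable_EFinP; apply: measurable_funM; last exact: (rintegrable_measurable iw).
  apply: (eq_measurable_fun (fun t => (complex.Re (u1 t) - complex.Re (u2 t)) ^+ 2 +
    (complex.Im (u1 t) - complex.Im (u2 t)) ^+ 2)).
    by move=> t _; rewrite /sqmod; case: (u1 t) (u2 t) => [a b] [c e].
  by apply: measurable_funD; apply: measurable_funX; exact: measurable_funB.
apply: (@filterS2 _ _ (ae_filter_ringOfSetsType mu) _ _ _ _ aU aV) => t Ut Vt Dt.
rewrite -EFinM; congr (_%:E).
move: (Ut Dt) (Vt Dt); rewrite /sqmod; case: (u1 t) (u2 t) => [a b] [c e] /= H1 H2.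
by rewrite !expr2 mulrDl -!mulrA H1 H2 !mulr0 addr0.
Qed.

End SurfaceMoments.

Lemma complex_pairI (R : realType) (a b c d : R) :
  a%:C%C + 'i%C * b%:C%C = c%:C%C + 'i%C * d%:C%C -> (a, b) = (c, d).
Proof.
move=> /eqP; rewrite eq_complex /= => /andP[/eqP].
by rewrite !(mul0r, mul1r, subr0, addr0, add0r) => -> /eqP ->.
Qed.

(** * The circle *)

Section CircleCase.
Context {R : realType} (k r : R) (k0 : 0 < k) (r0 : 0 < r).
Notation leb := (@lebesgue_measure R).
Notation D := (@circle_dom R : set (measurableTypeR R)).

Lemma measurable_circle_dom : measurable D.
Proof. exact: measurable_itv. Qed.

Lemma circle_coord (i : 'I_2) (t : R) :
  circle_pt 2 r t ord0 i = if i == ord0 then r * cos t else r * sin t.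
Proof. by rewrite mxE; case: i => -[|[|]]. Qed.

Lemma sqn_circle (t : R) : sqn (circle_pt 2 r t) = r ^+ 2.
Proof.
rewrite /sqn !big_ord_recl big_ord0 !circle_coord /= addr0 !exprMn -mulrDr.
by rewrite cos2Dsin2 mulr1.
Qed.

Lemma measurable_circle_coord i : measurable_fun D (fun t => circle_pt 2 r t ord0 i).
Proof.
apply: (eq_measurable_fun (fun t => if i == ord0 then r * cos t else r * sin t)).
  by move=> t _; rewrite circle_coord.
by case: (i == ord0); apply: measurable_funM => //; apply: measurable_funTS;
  apply: continuous_measurable_fun; [exact: continuous_cos|exact: continuous_sin].
Qed.

Lemma circle_weight : rintegrable leb D (fun=> r).
Proof.
have fin : (leb D < +oo)%E.
  rewrite [X in leb X](_ : _ = [set` `[0, 2 * pi[]) // lebesgue_measure_itv.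
  by rewrite /= lte_fin mulr_gt0 ?pi_gt0 // -EFinB ltry.
apply: measurable_bounded_integrable => //.
  exact: measurable_circle_dom.
exact: bounded_cst.
Qed.

Lemma circle_L2 u : @L2S R 2 r u ->
  weighted_L2 leb D (fun=> r) (fun t => u (circle_pt 2 r t)).
Proof. by move=> [[m1 m2] uoo]; split. Qed.

Lemma circle_mom_ae (W : R -> R) : rintegrable leb D W ->
  (forall v n, \int[leb]_(t in D) (W t * dotp v (circle_pt 2 r t) ^+ n) = 0) ->
  {ae leb, forall t, D t -> W t = 0}.
Proof.
move=> iW mom.
have mcos : measurable_fun D (fun t => r * cos t).
  apply: measurable_funM => //; apply: measurable_funTS.
  by apply: continuous_measurable_fun; exact: continuous_cos.
have msin : measurable_fun D (fun t => r * sin t).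
  apply: measurable_funM => //; apply: measurable_funTS.
  by apply: continuous_measurable_fun; exact: continuous_sin.
have H : forall i j, \int[leb]_(t in D) (W t * ((r * cos t) ^+ i * (r * sin t) ^+ j)) = 0.
  apply: (binomial_moments (C := r) measurable_circle_dom iW mcos msin).
  - by move=> t _; rewrite normrM gtr0_norm // ger_pMr // cos_max.
  - by move=> t _; rewrite normrM gtr0_norm // ger_pMr // ler_norml sin_geN1 sin_le1.
  (* The directions [(1, z)] give the powers of [X + z * Y] required for polarisation. *)
  - move=> n z; rewrite -[RHS](mom (\row_i nth 0 [:: 1; z] i) n).
    apply: Rintegral_eq => t _; congr (_ * _ ^+ n).
    by rewrite /dotp !big_ord_recl big_ord0 !circle_coord !mxE /= mul1r addr0.
apply: circle_moments => // a b.
have ip : rintegrable leb D (fun t => W t * ((r * cos t) ^+ a * (r * sin t) ^+ b)).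
  apply: (rintegrable_mul_bounded measurable_circle_dom iW (C := r ^+ a * r ^+ b)).
    by apply: measurable_funM; exact: measurable_funX.
  move=> t _; rewrite normrM !normrX !normrM (gtr0_norm r0).
  apply: ler_pM; rewrite ?exprn_ge0 ?mulr_ge0 // ?(ltW r0) //.
    by apply: lerXn2r; rewrite ?nnegrE ?mulr_ge0 ?(ltW r0) // ger_pMr // cos_max.
  by apply: lerXn2r; rewrite ?nnegrE ?mulr_ge0 ?(ltW r0) // ger_pMr // ler_norml sin_geN1 sin_le1.
transitivity ((r ^+ (a + b))^-1 * \int[leb]_(t in D) (W t * ((r * cos t) ^+ a * (r * sin t) ^+ b))).
  rewrite -(RintegralZl _ measurable_circle_dom ip); apply: Rintegral_eq => t _.
  have rn : r ^+ (a + b) != 0 by rewrite expf_neq0 // gt_eqF.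
  apply: (mulfI rn); rewrite [RHS]mulrA divff // mul1r !exprMn exprD; ring.
by rewrite H mulr0.
Qed.

Lemma circle_injective (Omega : set 'rV[R]_2) (u1 u2 : 'rV[R]_2 -> R[i]) :
  open Omega -> Omega !=set0 -> Omega `<=` @eball R 2 r ->
  L2S r u1 -> L2S r u2 ->
  (forall x, Omega x -> opT k r u1 x = opT k r u2 x) ->
  surf_int r (fun y => (sqmod (u1 y - u2 y))%:E) = 0%E.
Proof.
move=> oO O0 Or h1 h2 E; have [A [B hK]] := kernel_circle k0.
have mD := measurable_circle_dom.
have w0 (t : R) : D t -> 0 <= r by rewrite ltW.
have E' x : Omega x -> surface_potential leb D (@circle_pt R 2 r) k (fun=> r) (fun t => u1 (circle_pt 2 r t)) x
    = surface_potential leb D (@circle_pt R 2 r) k (fun=> r) (fun t => u2 (circle_pt 2 r t)) x.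
  by move=> /E /complex_pairI.
have [iU iV mom] := surface_moments mD measurable_circle_coord r0 k0
  (fun t _ => sqn_circle t) hK circle_weight w0 oO O0 Or (circle_L2 h1) (circle_L2 h2) E'.
apply: (surface_ae_eq mD circle_weight (circle_L2 h1) (circle_L2 h2)).
  by apply: circle_mom_ae => // v n; case: (mom v n).
by apply: circle_mom_ae => // v n; case: (mom v n).
Qed.

End CircleCase.

(** * The sphere *)

Section SphereCase.
Context {R : realType} (k r : R) (k0 : 0 < k) (r0 : 0 < r).
Notation leb := (@lebesgue_measure R).
Notation leb2 := (leb \x leb)%E.
Notation D := (@sphere_dom R : set (measurableTypeR R * measurableTypeR R)).

Lemma sphere_coord (i : 'I_3) (z : R * R) : sphere_pt 3 r z ord0 i =
  if i == 0 :> nat then r * (sin z.1 * cos z.2) else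
  if i == 1%N :> nat then r * (sin z.1 * sin z.2) else r * cos z.1.
Proof. by rewrite mxE; case: i => -[|[|[|]]] //= _; rewrite mulrA. Qed.

Lemma sqn_sphere (z : R * R) : sqn (sphere_pt 3 r z) = r ^+ 2.
Proof.
rewrite /sqn !big_ord_recl big_ord0 !sphere_coord /= addr0 !exprMn.
have := cos2Dsin2 z.1; have := cos2Dsin2 z.2.
move: (cos z.1) (sin z.1) (cos z.2) (sin z.2) => c s c' s' E1 E2.
transitivity (r ^+ 2 * (c ^+ 2 + s ^+ 2 * (c' ^+ 2 + s' ^+ 2))); first ring.
by rewrite E1 mulr1 E2 mulr1.
Qed.

Lemma measurable_fst_comp (f : R -> R) : continuous f ->
  measurable_fun D (fun z => f z.1).
Proof.
move=> cf; apply: measurable_funTS; apply: measurableT_comp => //.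
exact: continuous_measurable_fun.
Qed.

Lemma measurable_snd_comp (f : R -> R) : continuous f ->
  measurable_fun D (fun z => f z.2).
Proof.
move=> cf; apply: measurable_funTS; apply: measurableT_comp => //.
exact: continuous_measurable_fun.
Qed.

Let mX : measurable_fun D (fun z => r * (sin z.1 * cos z.2)).
Proof.
apply: measurable_funM => //; apply: measurable_funM.
  by apply: measurable_fst_comp; exact: continuous_sin.
by apply: measurable_snd_comp; exact: continuous_cos.
Qed.

Let mY : measurable_fun D (fun z => r * (sin z.1 * sin z.2)).
Proof.
apply: measurable_funM => //; apply: measurable_funM.
  by apply: measurable_fst_comp; exact: continuous_sin.
by apply: measurable_snd_comp; exact: continuous_sin.
Qed.

Let mZ : measurable_fun D (fun z => r * cos z.1).
Proof.
by apply: measurable_funM => //; apply: measurable_fst_comp; exact: continuous_cos.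
Qed.

Lemma measurable_sphere_coord i : measurable_fun D (fun z => sphere_pt 3 r z ord0 i).
Proof.
apply: (eq_measurable_fun (fun z => if i == 0 :> nat then r * (sin z.1 * cos z.2) else
  if i == 1%N :> nat then r * (sin z.1 * sin z.2) else r * cos z.1)).
  by move=> z _; rewrite sphere_coord.
by case: (_ == _) => //; case: (_ == _).
Qed.

Lemma sphere_weight : rintegrable leb2 D (fun z => r ^+ 2 * sin z.1).
Proof.
have fin : (leb2 D < +oo)%E.
  have -> : leb2 D = (leb [set` `[0%R, pi]] * leb [set` `[0%R, (2 * pi)%R[])%E.
    by apply: product_measure1E; exact: measurable_itv.
  rewrite !lebesgue_measure_itv /= !lte_fin pi_gt0 mulr_gt0 ?pi_gt0 //.
  by rewrite -!EFinB -EFinM ltry.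
apply: measurable_bounded_integrable => //.
- exact: measurable_sphere_dom.
- by apply: measurable_funM => //; apply: measurable_fst_comp; exact: continuous_sin.
- exists (r ^+ 2); split; first exact: num_real.
  move=> M rM z _ /=; apply: le_trans (ltW rM).
  by rewrite normrM ger0_norm ?sqr_ge0 // ler_piMr ?sqr_ge0 // ler_norml sin_geN1 sin_le1.
Qed.

Lemma sphere_weight_ge0 z : D z -> 0 <= r ^+ 2 * sin z.1.
Proof.
move=> [z1 _]; rewrite mulr_ge0 ?sqr_ge0 //; apply: sin_ge0_pi.
by move: z1; rewrite /= in_itv.
Qed.

Lemma sphere_L2 u : @L2S R 3 r u ->
  weighted_L2 leb2 D (fun z => r ^+ 2 * sin z.1) (fun z => u (sphere_pt 3 r z)).
Proof. by move=> [[m1 m2] uoo]; split. Qed.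

Lemma sphere_mom_ae (W : R * R -> R) : rintegrable leb2 D W ->
  (forall v n, \int[leb2]_(z in D) (W z * dotp v (sphere_pt 3 r z) ^+ n) = 0) ->
  {ae leb2, forall z, D z -> W z = 0}.
Proof.
move=> iW mom; have mD := @measurable_sphere_dom R.
have s1 (x : R) : `|sin x| <= 1 by rewrite ler_norml sin_geN1 sin_le1.
have c1 (x : R) : `|cos x| <= 1 by exact: cos_max.
have bX (z : R * R) : `|r * (sin z.1 * cos z.2)| <= r.
  by rewrite normrM gtr0_norm // ger_pMr // normrM mulr_ile1.
have bY (z : R * R) : `|r * (sin z.1 * sin z.2)| <= r.
  by rewrite normrM gtr0_norm // ger_pMr // normrM mulr_ile1.
have bZ (z : R * R) : `|r * cos z.1| <= r.
  by rewrite normrM gtr0_norm // ger_pMr.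
(* Polarisation is applied twice to the directions [(1, b, c)]: here in [c], to separate the
   vertical coordinate, and in [H2] in [b], to separate the two horizontal ones. *)
have H1 b i j : \int[leb2]_(z in D) (W z * ((r * (sin z.1 * cos z.2) + b * (r * (sin z.1 * sin z.2))) ^+ i
    * (r * cos z.1) ^+ j)) = 0.
  have mXY : measurable_fun D (fun z => r * (sin z.1 * cos z.2) + b * (r * (sin z.1 * sin z.2))).
    by apply: measurable_funD => //; apply: measurable_funM.
  apply: (binomial_moments (C := r + `|b| * r) mD iW mXY mZ).
  - move=> z _; apply: le_trans (ler_normD _ _) _; apply: lerD; first exact: bX.
    by rewrite (normrM b); apply: ler_wpM2l => //; exact: bY.
  - by move=> z _; apply: le_trans (bZ z) _; rewrite lerDl mulr_ge0 // ltW.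
  - move=> n c; rewrite -[RHS](mom (\row_i nth 0 [:: 1; b; c] i) n).
    apply: Rintegral_eq => z _; congr (_ * _ ^+ n).
    by rewrite /dotp !big_ord_recl big_ord0 !sphere_coord !mxE /= mul1r addr0 addrA.
have H2 a b j : \int[leb2]_(z in D) (W z * (r * cos z.1) ^+ j *
    ((r * (sin z.1 * cos z.2)) ^+ a * (r * (sin z.1 * sin z.2)) ^+ b)) = 0.
  have iWj : rintegrable leb2 D (fun z => W z * (r * cos z.1) ^+ j).
    apply: (rintegrable_mul_bounded mD iW (C := r ^+ j)); first exact: measurable_funX.
    by move=> z _; rewrite normrX; apply: lerXn2r; rewrite ?nnegrE ?(ltW r0).
  apply: (binomial_moments (C := r) mD iWj mX mY) => // n c.
  by rewrite -[RHS](H1 c n j); apply: Rintegral_eq => z _; rewrite -mulrA; congr (_ * _); exact: mulrC.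
have mW := measurable_int _ iW.
suff : (\int[leb2]_(z in D) `|(EFin \o W) z| = 0)%E.
  by move=> /(ae_eq_integral_abs leb2 mD mW); apply: (@filterS _ _ (ae_filter_ringOfSetsType leb2)) => z H /H [].
apply: (sphere_moments iW) => a b j.
have ip : rintegrable leb2 D (fun z => W z * (r * cos z.1) ^+ j *
    ((r * (sin z.1 * cos z.2)) ^+ a * (r * (sin z.1 * sin z.2)) ^+ b)).
  apply: (rintegrable_eq mD (f := fun z => W z * ((r * cos z.1) ^+ j *
    ((r * (sin z.1 * cos z.2)) ^+ a * (r * (sin z.1 * sin z.2)) ^+ b)))).
    by move=> z _; rewrite mulrA.
  apply: (rintegrable_mul_bounded mD iW (C := r ^+ j * (r ^+ a * r ^+ b))).
    by apply: measurable_funM; [|apply: measurable_funM]; exact: measurable_funX.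
  have bp n (q : R) : `|q| <= r -> `|q ^+ n| <= r ^+ n.
    by move=> qr; rewrite normrX; apply: lerXn2r; rewrite ?nnegrE ?(ltW r0).
  move=> z _; rewrite !(normrM (_ ^+ _)).
  by apply: ler_pM => //; [exact: bp|apply: ler_pM => //; exact: bp].
transitivity ((r ^+ (j + (a + b)))^-1 * \int[leb2]_(z in D) (W z * (r * cos z.1) ^+ j *
    ((r * (sin z.1 * cos z.2)) ^+ a * (r * (sin z.1 * sin z.2)) ^+ b))).
  rewrite -(RintegralZl _ mD ip); apply: Rintegral_eq => z _.
  have rn : r ^+ (j + (a + b)) != 0 by rewrite expf_neq0 // gt_eqF.
  apply: (mulfI rn); rewrite [RHS]mulrA divff // mul1r.
  by rewrite !(exprMn _ r) !exprD; ring.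
by rewrite H2 mulr0.
Qed.

Lemma sphere_injective (Omega : set 'rV[R]_3) (u1 u2 : 'rV[R]_3 -> R[i]) :
  open Omega -> Omega !=set0 -> Omega `<=` @eball R 3 r ->
  L2S r u1 -> L2S r u2 ->
  (forall x, Omega x -> opT k r u1 x = opT k r u2 x) ->
  surf_int r (fun y => (sqmod (u1 y - u2 y))%:E) = 0%E.
Proof.
move=> oO O0 Or h1 h2 E; have [A [B hK]] := kernel_sphere k0.
have mD := @measurable_sphere_dom R.
pose w (z : R * R) : R := r ^+ 2 * sin z.1.
have E' x : Omega x -> surface_potential leb2 D (@sphere_pt R 3 r) k w (fun z => u1 (sphere_pt 3 r z)) x
    = surface_potential leb2 D (@sphere_pt R 3 r) k w (fun z => u2 (sphere_pt 3 r z)) x.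
  by move=> /E /complex_pairI.
have [iU iV mom] := surface_moments mD measurable_sphere_coord r0 k0
  (fun z _ => sqn_sphere z) hK sphere_weight sphere_weight_ge0 oO O0 Or (sphere_L2 h1) (sphere_L2 h2) E'.
apply: (surface_ae_eq mD sphere_weight (sphere_L2 h1) (sphere_L2 h2)).
  by apply: sphere_mom_ae => // v n; case: (mom v n).
by apply: sphere_mom_ae => // v n; case: (mom v n).
Qed.

End SphereCase.

Theorem theorem1 (R : realType) (N : nat) (hN : N = 2%N \/ N = 3%N)
  (k r : R) (hk : 0 < k) (hr : 0 < r)
  (Omega : set 'rV[R]_N) (hOpen : open Omega) (hNe : Omega !=set0)
  (hSub : Omega `<=` eball r)
  (u1 u2 : 'rV[R]_N -> R[i]) (h1 : L2S r u1) (h2 : L2S r u2)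
  (hT : forall x, Omega x -> opT k r u1 x = opT k r u2 x) :
  surf_int r (fun y => (sqmod (u1 y - u2 y))%:E) = 0%E.
Proof.
case: hN => hN; subst N.
  exact: (circle_injective hk hr hOpen hNe hSub h1 h2 hT).
exact: (sphere_injective hk hr hOpen hNe hSub h1 h2 hT).
Qed.
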